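(* Let $n\ge 1$ and let $x_1,\ldots,x_n$ be one-dimensional observables on a $\mathrm{Rad}$-Dedekind $\sigma$-complete perfect MV-algebra $M$. Then there is a unique $n$-dimensional observable $x$ on $M$ such that $$x((-\infty,s_1)\times\cdots\times(-\infty,s_n))=\bigwedge_{i=1}^n x_i((-\infty,s_i)),\qquad s_1,\ldots,s_n\in\mathbb R.$$
   Context: A $\mathrm{Rad}$-Dedekind $\sigma$-complete perfect MV-algebra is, up to isomorphism, an MV-algebra $M=\Gamma(\mathbb Z\,\overrightarrow{\times}\,G,(1,0))$ with $G$ a Dedekind $\sigma$-complete (Abelian) $\ell$-group, i.e. one in which every nonempty countable subset bounded above has a supremum. Here $\mathbb Z\,\overrightarrow{\times}\,G$ is $\mathbb Z\times G$ with lexicographic order ($(m,g)\le(m',g')$ iff $m<m'$, or $m=m'$ and $g\le g'$), and $\Gamma(\mathbb Z\,\overrightarrow{\times}\,G,(1,0))$ is the interval $[(0,0),(1,0)]$ with its usual MV-algebra structure ($a\oplus b=(a+b)\wedge(1,0)$, $a'=(1,0)-a$); bottom $0=(0,0)$, top $1=(1,0)$. The partial addition $a+b$ on $M$ is the group sum, defined when it is $\le(1,0)$. An $n$-dimensional observable on $M$ is a map $x:\mathcal B(\mathbb R^n)\to M$ on the Borel $\sigma$-algebra such that $x(\mathbb R^n)=1$; $x(A\cup B)=x(A)+x(B)$ (the sum being defined in $M$) for disjoint Borel sets $A,B$; and $x(\bigcup_iA_i)=\bigvee_i x(A_i)$ (supremum in $M$) for every non-decreasing sequence $(A_i)_i$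 of Borel sets. *)

(* Defs.v *)
From HB Require Import structures.
From mathcomp Require Import all_boot all_order all_algebra.
From mathcomp Require Import all_classical all_reals all_analysis.

Set Implicit Arguments.
Unset Strict Implicit.
Unset Printing Implicit Defensive.

Import Order.TTheory GRing.Theory Num.Theory.
Import numFieldNormedType.Exports.

Local Open Scope classical_set_scope.
Local Open Scope ring_scope.

(** The lattice operations are part of the structure, as [Order.Lattice] cannot
    be joined with [GRing.Zmodule] below [Num.RealDomain]. *)
HB.mixin Record POrderedZmodule_isLGroup G of Num.POrderedZmodule G := {
  lmeet : G -> G -> G;
  ljoin : G -> G -> G;
  le_lmeet : forall x y z : G, (x <= lmeet y z) = (x <= y) && (x <= z);
  ljoin_le : forall x y z : G, (ljoin x y <= z) = (x <= z) && (y <= z);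
  lgroup_leD2l : forall z x y : G, x <= y -> z + x <= z + y
}.

#[short(type="lGroupType")]
HB.structure Definition LGroup :=
  { G of Num.POrderedZmodule G & POrderedZmodule_isLGroup G }.

Definition dedekind_sigma_complete (G : lGroupType) : Prop :=
  forall A : set G, countable A -> has_sup A -> supremums A !=set0.

Section LGroupTheory.
Context {G : lGroupType}.
Implicit Types x y z : G.

Lemma ge_lmeetl x y : lmeet x y <= x.
Proof. by have := lexx (lmeet x y); rewrite le_lmeet => /andP[]. Qed.

Lemma ge_lmeetr x y : lmeet x y <= y.
Proof. by have := lexx (lmeet x y); rewrite le_lmeet => /andP[]. Qed.

Lemma le_ljoinl x y : x <= ljoin x y.
Proof. by have := lexx (ljoin x y); rewrite ljoin_le => /andP[]. Qed.

Lemma le_ljoinr x y : y <= ljoin x y.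
Proof. by have := lexx (ljoin x y); rewrite ljoin_le => /andP[]. Qed.

Lemma lmeetC : commutative (@lmeet G).
Proof. by move=> x y; apply: le_anti; rewrite !le_lmeet !ge_lmeetl !ge_lmeetr. Qed.

Lemma ljoinC : commutative (@ljoin G).
Proof. by move=> x y; apply: le_anti; rewrite !ljoin_le !le_ljoinl !le_ljoinr. Qed.

Lemma lmeetA : associative (@lmeet G).
Proof.
move=> x y z; apply: le_anti; rewrite !le_lmeet !(ge_lmeetl, ge_lmeetr) /= ?andbT.
rewrite (le_trans (ge_lmeetr _ _) (ge_lmeetl _ _)).
rewrite (le_trans (ge_lmeetr _ _) (ge_lmeetr _ _)).
rewrite (le_trans (ge_lmeetl _ _) (ge_lmeetl _ _)).
by rewrite (le_trans (ge_lmeetl _ _) (ge_lmeetr _ _)).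
Qed.

Lemma lmeet_idPl x y : reflect (lmeet x y = x) (x <= y).
Proof.
apply: (iffP idP) => [xy|<-]; last exact: ge_lmeetr.
by apply: le_anti; rewrite ge_lmeetl le_lmeet lexx xy.
Qed.

Lemma lmeet_idPr x y : reflect (lmeet x y = y) (y <= x).
Proof. by rewrite lmeetC; exact: lmeet_idPl. Qed.

Lemma lgroup_le2l z x y : (z + x <= z + y) = (x <= y).
Proof.
apply/idP/idP; last exact: lgroup_leD2l.
by move=> /(lgroup_leD2l (- z)); rewrite !addKr.
Qed.

Lemma lgroup_le2r z x y : (x + z <= y + z) = (x <= y).
Proof. by rewrite ![_ + z]addrC lgroup_le2l. Qed.

Lemma lgroup_leN2 x y : (- x <= - y) = (y <= x).
Proof. by rewrite -(lgroup_le2l (x + y) (- x)) addrK addrAC subrr add0r. Qed.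

Lemma lgroup_lesubr x y z : (x <= y - z) = (x + z <= y).
Proof. by rewrite -(lgroup_le2r z x) subrK. Qed.

Lemma lgroup_lesubl x y z : (x - z <= y) = (x <= y + z).
Proof. by rewrite -(lgroup_le2r z (x - z)) subrK. Qed.

Lemma lgroup_meetDr x y z : lmeet x y + z = lmeet (x + z) (y + z).
Proof.
apply: le_anti; rewrite le_lmeet !lgroup_le2r ge_lmeetl ge_lmeetr /=.
by rewrite -lgroup_lesubl le_lmeet !lgroup_lesubl ge_lmeetl ge_lmeetr.
Qed.

Lemma lgroup_joinDr x y z : ljoin x y + z = ljoin (x + z) (y + z).
Proof.
apply: le_anti; rewrite ljoin_le !lgroup_le2r le_ljoinl le_ljoinr /= andbT.
by rewrite -lgroup_lesubr ljoin_le !lgroup_lesubr le_ljoinl le_ljoinr.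
Qed.

Lemma lgroup_oppI x y : - lmeet x y = ljoin (- x) (- y).
Proof.
apply: le_anti; rewrite ljoin_le !lgroup_leN2 ge_lmeetl ge_lmeetr /= andbT.
rewrite -[leRHS]opprK lgroup_leN2 le_lmeet.
by rewrite -[leRHS]opprK lgroup_leN2 le_ljoinl -[leRHS]opprK lgroup_leN2 le_ljoinr.
Qed.

End LGroupTheory.

Definition lexZ (G : Type) : Type := (int * G)%type.

Section LexZ.
Context {G : lGroupType}.

HB.instance Definition _ := GRing.Zmodule.copy (lexZ G) (int * G)%type.

Implicit Types a b c : lexZ G.

Definition lexZ_le a b := (a.1 < b.1) || (a.1 == b.1) && (a.2 <= b.2).

Definition lexZ_meet a b : lexZ G :=
  if a.1 < b.1 then a else if b.1 < a.1 then b else (a.1, lmeet a.2 b.2).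

Definition lexZ_join a b : lexZ G :=
  if a.1 < b.1 then b else if b.1 < a.1 then a else (a.1, ljoin a.2 b.2).

Lemma lexZ_le_refl : reflexive lexZ_le.
Proof. by move=> a; rewrite /lexZ_le eqxx lexx orbT. Qed.

Lemma lexZ_le_anti : antisymmetric lexZ_le.
Proof.
move=> [m g] [k h]; rewrite /lexZ_le /= => /andP[].
case: (ltgtP m k) => //= -> gh hg.
by congr pair; apply: le_anti; rewrite gh hg.
Qed.

Lemma lexZ_le_trans : transitive lexZ_le.
Proof.
move=> [k h] [m g] [l f]; rewrite /lexZ_le /=.
case/orP=> [mk|/andP[/eqP-> gh]].
  by case/orP=> [kl|/andP[/eqP<- _]]; rewrite ?mk // (lt_trans mk kl).
by case/orP=> [->//|/andP[-> hf]]; rewrite (le_trans gh hf) orbT.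
Qed.

HB.instance Definition _ := Order.Le_isPOrder.Build ring_display (lexZ G)
  lexZ_le_refl lexZ_le_anti lexZ_le_trans.

Lemma lexZ_leE a b :
  (a <= b) = (a.1 < b.1) || (a.1 == b.1) && (a.2 <= b.2).
Proof. by []. Qed.

Lemma lexZ_meetP a b c : (a <= lexZ_meet b c) = (a <= b) && (a <= c).
Proof.
case: a b c => [m g] [k h] [l f]; rewrite !lexZ_leE /lexZ_meet /=.
case: (ltgtP k l) => [kl|lk|<-] /=.
- case: (ltgtP m k) => [mk|km|->] /=; rewrite ?(lt_trans mk kl) //.
  by rewrite kl andbT.
- case: (ltgtP m l) => [ml|lm|->] /=; rewrite ?(lt_trans ml lk) ?andbF //.
  by rewrite lk.
- by case: ltgtP => //= _; rewrite le_lmeet.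
Qed.

Lemma lexZ_joinP a b c : (lexZ_join a b <= c) = (a <= c) && (b <= c).
Proof.
case: a b c => [m g] [k h] [l f]; rewrite !lexZ_leE /lexZ_join /=.
case: (ltgtP m k) => [mk|km|<-] /=.
- case: (ltgtP k l) => [kl|lk|<-] /=; rewrite ?(lt_trans mk kl) ?andbF //.
  by rewrite mk.
- case: (ltgtP m l) => [ml|lm|<-] /=; rewrite ?(lt_trans km ml) //.
  by rewrite km andbT.
- by case: ltgtP => //= _; rewrite ljoin_le.
Qed.

Lemma lexZ_leD2l a b c : b <= c -> a + b <= a + c.
Proof. by rewrite !lexZ_leE /= ltrD2l (inj_eq (addrI _)) lgroup_le2l. Qed.

HB.instance Definition _ := POrderedZmodule_isLGroup.Build (lexZ G)
  lexZ_meetP lexZ_joinP lexZ_leD2l.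

End LexZ.

Definition lexZ_unit (G : lGroupType) : lexZ G := (1, 0).

Lemma lexZ_unit_ge0 (G : lGroupType) : 0 <= lexZ_unit G.
Proof. by rewrite lexZ_leE. Qed.

HB.mixin Record isMVAlgebra M := {
  mv_zero : M;
  mv_oplus : M -> M -> M;
  mv_neg : M -> M;
  mv_oplusA : associative mv_oplus;
  mv_oplusC : commutative mv_oplus;
  mv_oplus0 : right_id mv_zero mv_oplus;
  mv_negK : involutive mv_neg;
  mv_oplusN0 : forall a, mv_oplus a (mv_neg mv_zero) = mv_neg mv_zero;
  mv_lukasiewicz : forall a b,
    mv_oplus (mv_neg (mv_oplus (mv_neg a) b)) b =
    mv_oplus (mv_neg (mv_oplus (mv_neg b) a)) a
}.

#[short(type="mvAlgebraType")]
HB.structure Definition MVAlgebra := { M of isMVAlgebra M }.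

Section MVOperations.
Context {M : mvAlgebraType}.
Implicit Types (a b c : M) (A : set M).

Definition mv_one : M := mv_neg mv_zero.

Definition mv_le a b : Prop := mv_oplus (mv_neg a) b = mv_one.

Definition mv_join a b : M := mv_oplus (mv_neg (mv_oplus (mv_neg a) b)) b.

Definition mv_meet a b : M := mv_neg (mv_join (mv_neg a) (mv_neg b)).

(** [mv_psum a b c]: the partial sum of [a] and [b] is defined and equals [c]. *)
Definition mv_psum a b c : Prop := mv_le a (mv_neg b) /\ c = mv_oplus a b.

Definition mv_is_sup A c : Prop :=
  (forall a, A a -> mv_le a c) /\
  (forall b, (forall a, A a -> mv_le a b) -> mv_le c b).

End MVOperations.

Definition mv_isomorphic (M N : mvAlgebraType) : Prop :=
  exists f : M -> N,
    [/\ bijective f, f mv_zero = mv_zero,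
        forall a b, f (mv_oplus a b) = mv_oplus (f a) (f b)
      & forall a, f (mv_neg a) = mv_neg (f a)].

Record Gamma (H : lGroupType) (u : H) (u_ge0 : 0 <= u) : Type :=
  MkGamma { gval : H; gvalP : 0 <= gval <= u }.

Section GammaMV.
Context {H : lGroupType} {u : H} {u_ge0 : 0 <= u}.
Local Notation Gu := (Gamma u_ge0).
Implicit Types a b c : Gu.

Lemma gval_inj : injective (@gval H u u_ge0).
Proof.
move=> [a ha] [b hb] /= ab; rewrite ab in ha *.
by congr MkGamma; exact: bool_irrelevance.
Qed.

Lemma gval_ge0 a : 0 <= gval a. Proof. by case/andP: (gvalP a). Qed.
Lemma gval_le1 a : gval a <= u. Proof. by case/andP: (gvalP a). Qed.

Fact Gamma_zero_subproof : 0 <= (0 : H) <= u.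
Proof. by rewrite lexx u_ge0. Qed.

Fact Gamma_oplus_subproof a b : 0 <= lmeet (gval a + gval b) u <= u.
Proof.
rewrite ge_lmeetr le_lmeet u_ge0 !andbT (le_trans (gval_ge0 a)) //.
by rewrite -[leLHS]addr0 lgroup_le2l gval_ge0.
Qed.

Fact Gamma_neg_subproof a : 0 <= u - gval a <= u.
Proof.
by rewrite lgroup_lesubr add0r gval_le1 lgroup_lesubl -{1}[u]addr0
  lgroup_le2l gval_ge0.
Qed.

Definition Gamma_zero : Gu := MkGamma u_ge0 Gamma_zero_subproof.
Definition Gamma_oplus a b : Gu := MkGamma u_ge0 (Gamma_oplus_subproof a b).
Definition Gamma_neg a : Gu := MkGamma u_ge0 (Gamma_neg_subproof a).

Lemma Gamma_oplusC : commutative Gamma_oplus.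
Proof. by move=> a b; apply: gval_inj; rewrite /= addrC. Qed.

Lemma Gamma_oplusA : associative Gamma_oplus.
Proof.
have E a b c : lmeet (lmeet (gval a + gval b) u + gval c) u =
    lmeet (gval a + gval b + gval c) u.
  rewrite lgroup_meetDr -lmeetA; congr (lmeet _ _); apply/lmeet_idPr.
  by rewrite -{1}[u]addr0 lgroup_le2l gval_ge0.
move=> a b c; apply: gval_inj => /=.
by rewrite E [gval a + _]addrC E addrC addrA.
Qed.

Lemma Gamma_oplus0 : right_id Gamma_zero Gamma_oplus.
Proof.
by move=> a; apply: gval_inj; rewrite /= addr0; apply/lmeet_idPl/gval_le1.
Qed.

Lemma Gamma_negK : involutive Gamma_neg.
Proof. by move=> a; apply: gval_inj; rewrite /= opprB addrC subrK. Qed.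

Lemma Gamma_oplusN0 a :
  Gamma_oplus a (Gamma_neg Gamma_zero) = Gamma_neg Gamma_zero.
Proof.
apply: gval_inj; rewrite /= subr0; apply/lmeet_idPr.
by rewrite -{1}[u]add0r lgroup_le2r gval_ge0.
Qed.

Lemma gval_join_subproof a b :
  gval (Gamma_oplus (Gamma_neg (Gamma_oplus (Gamma_neg a) b)) b) =
  ljoin (gval a) (gval b).
Proof.
rewrite /= lgroup_oppI [u + _]addrC !lgroup_joinDr addNr add0r.
have -> : - (u - gval a + gval b) + u + gval b = gval a.
  by rewrite opprD addrAC subrK opprB subrK.
by apply/lmeet_idPl; rewrite ljoin_le !gval_le1.
Qed.

Lemma Gamma_lukasiewicz a b :
  Gamma_oplus (Gamma_neg (Gamma_oplus (Gamma_neg a) b)) b =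
  Gamma_oplus (Gamma_neg (Gamma_oplus (Gamma_neg b) a)) a.
Proof. by apply: gval_inj; rewrite !gval_join_subproof ljoinC. Qed.

HB.instance Definition _ := isMVAlgebra.Build Gu
  Gamma_oplusA Gamma_oplusC Gamma_oplus0 Gamma_negK Gamma_oplusN0
  Gamma_lukasiewicz.

(** In [Gamma u_ge0] the MV-order, join and meet are those of the ambient
    l-group, and [mv_psum] is the group sum, defined when it is at most [u]. *)

Lemma gval_zero : gval (mv_zero : Gu) = 0. Proof. by []. Qed.

Lemma gval_one : gval (mv_one : Gu) = u. Proof. exact: subr0. Qed.

Lemma gval_oplus a b : gval (mv_oplus a b) = lmeet (gval a + gval b) u.
Proof. by []. Qed.

Lemma gval_neg a : gval (mv_neg a) = u - gval a. Proof. by []. Qed.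

Lemma gval_join a b : gval (mv_join a b) = ljoin (gval a) (gval b).
Proof. exact: gval_join_subproof. Qed.

Lemma gval_meet a b : gval (mv_meet a b) = lmeet (gval a) (gval b).
Proof.
rewrite gval_neg gval_join !gval_neg -[ljoin _ _]opprK.
by rewrite -[u - gval a]opprK -[u - gval b]opprK -lgroup_oppI !opprK !opprB
  [u + _]addrC lgroup_meetDr !subrK.
Qed.

Lemma mv_le_gval a b : mv_le a b <-> gval a <= gval b.
Proof.
have E : (gval a <= gval b) = (u <= u - gval a + gval b).
  by rewrite addrAC lgroup_lesubr lgroup_le2l.
rewrite E; split=> [/(congr1 (@gval _ _ _))|/lmeet_idPr ab].
  by rewrite gval_oplus gval_one => /lmeet_idPr.
by apply: gval_inj; rewrite gval_oplus gval_one.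
Qed.

Lemma mv_psum_gval a b c : mv_psum a b c <-> gval c = gval a + gval b.
Proof.
rewrite /mv_psum mv_le_gval gval_neg lgroup_lesubr; split=> [[ab ->]|cE].
  by rewrite gval_oplus; apply/lmeet_idPl.
split; first by rewrite -cE gval_le1.
by apply: gval_inj; rewrite gval_oplus -cE; apply/esym/lmeet_idPl/gval_le1.
Qed.

End GammaMV.

(** These algebras are taken through their representation theorem: up to
    isomorphism they are the intervals [(0, 0), (1, 0)] of the lexicographic
    products of the integers with a Dedekind sigma-complete l-group. *)
Definition rad_dedekind_sigma_complete_perfect (M : mvAlgebraType) : Prop :=
  exists G : lGroupType,
    dedekind_sigma_complete G /\ mv_isomorphic M (Gamma (lexZ_unit_ge0 G)).

Definition borel (T : topologicalType) : set (set T) := <<s @open T >>.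

(** As for measures, an observable is a total function on [set T] of which only
    the values on the Borel sets are meaningful. *)
Definition observable (T : topologicalType) (M : mvAlgebraType)
    (x : set T -> M) : Prop :=
  [/\ x setT = mv_one,
      forall A B, borel A -> borel B -> A `&` B = set0 ->
        mv_psum (x A) (x B) (x (A `|` B))
    & forall A : nat -> set T, (forall i, borel (A i)) ->
        (forall i, A i `<=` A i.+1) ->
        mv_is_sup (range (fun i => x (A i))) (x (\bigcup_i A i))].

Definition lower_orthant (R : realType) (n : nat) (s : 'I_n -> R) :
    set 'rV[R]_n := [set v | forall i, v ord0 i < s i].

(* Main.v *)
(** Write [M] as the interval of the lexicographic product [Z x G]. The integer
    part of a one-dimensional observable is a two-valued measure, a Dirac mass
    at some [t_i]; replacing [(1, 0)] by a large enough unit [u] of [G] turns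
    each [x_i] into a [G]-valued measure of total mass [u], and the integer part
    of the joint observable is the Dirac mass at [(t_1, ..., t_n)]. It remains
    to build a [G]-valued Borel measure on R^n with distribution function [min_i
    f_i(s_i)]. For real-valued [f_i] this is the law of [(q_1(w), ..., q_n(w))],
    the [q_i] being the quantile functions and [w] uniform on ]0, 1[. Elements
    of [G] are treated as real-valued functions on an ideal space of generic
    points: a decreasing sequence of positive elements meeting countably many
    dense sets decides an additive, lattice-preserving evaluation in R that
    respects any countable list of suprema fixed in advance, and generic points
    separate the elements of [G] (Rasiowa-Sikorski). The sets [A] for which some
    element of [G] takes generically the value of the real-valued law at [A]
    form a lambda-system containing the orthants, hence all Borel sets; that
    element is the measure of [A]. *)
Require Import Defs.
From mathcomp Require Import all_boot all_order all_algebra.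
From mathcomp Require Import all_classical all_reals all_analysis.
From mathcomp Require Import measurable_realfun lra.

Set Implicit Arguments.
Unset Strict Implicit.
Unset Printing Implicit Defensive.

Import Order.TTheory GRing.Theory Num.Theory.
Import numFieldNormedType.Exports.
Local Open Scope classical_set_scope.
Local Open Scope ring_scope.

(** * Lattice-ordered groups *)

Section LGroup.
Context {G : lGroupType}.
Implicit Types (a b c d p u x y z : G) (g : nat -> G).

Lemma lgroupD x y z t : x <= y -> z <= t -> x + z <= y + t :> G.
Proof.
by move=> xy zt; apply: (@le_trans _ _ (y + z));
  rewrite ?lgroup_le2l ?lgroup_le2r.
Qed.

Lemma lgroup_addr_ge0 x y : 0 <= x -> 0 <= y -> 0 <= x + y.
Proof. by move=> x0 y0; rewrite -[leLHS]addr0 lgroupD. Qed.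

Lemma lgroup_subr_ge0 x y : (0 <= x - y) = (y <= x).
Proof. by rewrite lgroup_lesubr add0r. Qed.

Lemma lgroup_leMn x y n : x <= y -> x *+ n <= y *+ n.
Proof. by move=> xy; elim: n => // n ih; rewrite !mulrSr lgroupD. Qed.

Lemma lgroup_leMn2l x m n : 0 <= x -> (m <= n)%N -> x *+ m <= x *+ n.
Proof.
move=> x0 /subnK <-; rewrite mulrnDr -[leLHS]add0r lgroup_le2r.
by rewrite -(mul0rn _ (n - m)) lgroup_leMn.
Qed.

Definition lpos x : G := ljoin x 0.

Lemma lpos_ge0 x : 0 <= lpos x. Proof. exact: le_ljoinr. Qed.
Lemma le_lpos x : x <= lpos x. Proof. exact: le_ljoinl. Qed.

Lemma lposD x y : lpos (x + y) <= lpos x + lpos y.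
Proof. by rewrite ljoin_le lgroupD ?lgroup_addr_ge0 ?lpos_ge0 ?le_lpos. Qed.

Lemma lposE x : lpos x = x + lpos (- x).
Proof. by rewrite [RHS]addrC /lpos lgroup_joinDr addNr add0r ljoinC. Qed.

Lemma lpos_disjoint x : lmeet (lpos x) (lpos (- x)) = 0.
Proof.
rewrite {1}lposE -{2}[lpos (- x)]add0r -lgroup_meetDr.
have -> : lmeet x 0 = - lpos (- x).
  by rewrite -[LHS]opprK lgroup_oppI oppr0.
by rewrite addNr.
Qed.

Lemma lmeet_le x y z t : x <= y -> z <= t -> lmeet x z <= lmeet y t.
Proof.
by move=> xy zt; rewrite le_lmeet (le_trans (ge_lmeetl _ _)) //=
  (le_trans (ge_lmeetr _ _)).
Qed.

Lemma lmeet_ge0 x y : 0 <= x -> 0 <= y -> 0 <= lmeet x y.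
Proof. by rewrite le_lmeet => -> ->. Qed.

(** Distributing the right-hand sum gives the meet of [p + p], [p + y], [x + p] and [x + y], each
    above [lmeet p (x + y)]. So positive elements disjoint from [p] are closed under sums, which
    makes [le_on p] additive and transitive. *)
Lemma lmeetDr_le p x y : 0 <= p -> 0 <= x -> 0 <= y ->
  lmeet p (x + y) <= lmeet p x + lmeet p y.
Proof.
move=> p0 x0 y0; have pm := ge_lmeetl p (x + y).
have le_add z t : 0 <= t -> z <= z + t.
  by move=> t0; rewrite -[leLHS]addr0 lgroup_le2l.
rewrite lgroup_meetDr le_lmeet ![_ + lmeet p y]addrC !lgroup_meetDr !le_lmeet.
rewrite [y + x]addrC ge_lmeetr andbT.
by rewrite !(le_trans pm) // ?le_add // [y + p]addrC le_add.
Qed.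

Lemma lmeet_eq0_le p q x y : 0 <= p -> 0 <= x -> p <= q -> x <= y ->
  lmeet q y = 0 -> lmeet p x = 0.
Proof.
move=> p0 x0 pq xy qy0; apply: le_anti.
by rewrite lmeet_ge0 // andbT -qy0 lmeet_le.
Qed.

Lemma lmeet_eq0_mulrn p x n : 0 <= p -> 0 <= x -> lmeet p x = 0 ->
  lmeet p (x *+ n) = 0.
Proof.
move=> p0 x0 px; elim: n => [|n ih]; first by rewrite mulr0n; exact/lmeet_idPr.
have xn0 : 0 <= x *+ n by rewrite -(mul0rn _ n) lgroup_leMn.
apply: le_anti; rewrite lmeet_ge0 ?lgroup_addr_ge0 // ?andbT ?mulrSr //.
  by rewrite (le_trans (lmeetDr_le _ _ _)) // px ih addr0.
by rewrite lgroup_addr_ge0.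
Qed.

(* Read as [a <= b] on the support of [p]. *)
Definition le_on p a b : bool := lmeet p (lpos (a - b)) == 0.

Lemma le_le_on p a b : 0 <= p -> a <= b -> le_on p a b.
Proof.
move=> p0 ab; rewrite /le_on; have -> : lpos (a - b) = 0.
  apply: le_anti; rewrite lpos_ge0 ljoin_le lexx !andbT.
  by rewrite lgroup_lesubl add0r.
exact/eqP/lmeet_idPr.
Qed.

Lemma le_onD p a b c d : 0 <= p -> le_on p a b -> le_on p c d ->
  le_on p (a + c) (b + d).
Proof.
move=> p0 /eqP ab /eqP cd; apply/eqP/le_anti.
rewrite lmeet_ge0 ?lpos_ge0 // andbT opprD addrACA.
rewrite (le_trans (lmeet_le (lexx p) (lposD _ _))) //.
by rewrite (le_trans (lmeetDr_le _ _ _)) ?lpos_ge0 // ab cd addr0.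
Qed.

Lemma le_on_trans p b a c : 0 <= p -> le_on p a b -> le_on p b c -> le_on p a c.
Proof.
move=> p0 ab bc; have := le_onD p0 ab bc.
by rewrite /le_on [b + c]addrC opprD addrACA subrr addr0.
Qed.

Lemma le_onMn p a b n : 0 <= p -> le_on p a b -> le_on p (a *+ n) (b *+ n).
Proof.
move=> p0 ab; elim: n => [|n ih]; first exact: le_le_on.
by rewrite !mulrSr le_onD.
Qed.

Lemma le_on_sub p q a b : 0 <= q -> q <= p -> le_on p a b -> le_on q a b.
Proof.
move=> q0 qp /eqP ab; apply/eqP.
by apply: lmeet_eq0_le ab; rewrite ?lpos_ge0.
Qed.

Lemma le_on_lpos p a b : 0 <= p -> p <= lpos (b - a) -> le_on p a b.
Proof.
move=> p0 pb; apply/eqP; apply: (@lmeet_eq0_le _ (lpos (b - a)) _ (lpos (a - b))).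
- by [].
- exact: lpos_ge0.
- by [].
- exact: lexx.
- by rewrite -[a - b]opprB lpos_disjoint.
Qed.

(** The witness [lmeet p (lpos (a - b))] is nonzero by assumption and disjoint from [lpos (b - a)].
    The density arguments of [generically_approx] and [gen_value_meet] rest on this dichotomy. *)
Lemma not_le_on p a b : 0 <= p -> ~~ le_on p a b ->
  exists q, [/\ 0 < q, q <= p & le_on q b a].
Proof.
move=> p0 nab; exists (lmeet p (lpos (a - b))); split.
- by rewrite lt_def nab lmeet_ge0 // lpos_ge0.
- exact: ge_lmeetl.
- apply: le_on_lpos; last exact: ge_lmeetr.
  by rewrite lmeet_ge0 // lpos_ge0.
Qed.

Lemma le_on_meet p a b : 0 <= p -> le_on p a b -> le_on p a (lmeet a b).
Proof.
move=> p0 ab; have -> : le_on p a (lmeet a b) = le_on p a b; last exact: ab.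
congr (lmeet p _ == 0); have -> : a - lmeet a b = lpos (a - b); last first.
  by apply: le_anti; rewrite le_lpos ljoin_le lexx lpos_ge0.
by rewrite lgroup_oppI addrC lgroup_joinDr addNr ljoinC [- b + a]addrC.
Qed.

(** If [j < i], then [p <= u <= u *+ (i - j)], so [p] equals its meet with the positive part of the
    difference and would vanish. *)
Lemma le_on_unit p u i j : 0 < p <= u -> le_on p (u *+ i) (u *+ j) -> (i <= j)%N.
Proof.
move=> /andP[p0 pu]; rewrite leqNgt; apply: contraTN => ji.
have u0 : 0 <= u by rewrite (le_trans (ltW p0)).
rewrite /le_on -mulrnBr ?(ltnW ji) //; apply: contraTneq p0 => pi.
suff -> : p = 0 by rewrite ltxx.
have pui : p <= u *+ (i - j).
  by rewrite (le_trans pu) // -{1}[u]mulr1n lgroup_leMn2l // subn_gt0.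
rewrite -pi; apply/esym/lmeet_idPl; exact: le_trans (le_lpos _).
Qed.

(** * Suprema of sequences and the Archimedean property *)

Definition seq_sup g x : Prop :=
  (forall j, g j <= x) /\ forall b, (forall j, g j <= b) -> x <= b.

(** Induction on [m]. For fixed [i], evaluating the bound at [maxn i j] puts [p - (x - g i) *+ m]
    below every gap [x - g j]. Subtracting it from [x] leaves an upper bound of [g], so it is at
    most 0. *)
Lemma seq_sup_gap g x p m : (forall i j, (i <= j)%N -> g i <= g j) ->
  seq_sup g x -> (forall j, p <= (x - g j) *+ m) -> p <= 0.
Proof.
move=> gnd [gx xmin]; elim: m => [|m ih] pm; first exact: pm 0%N.
apply: ih => i.
suff : x <= x - (p - (x - g i) *+ m).
  by rewrite lgroup_lesubr -[leRHS]addr0 lgroup_le2l lgroup_lesubl add0r.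
apply: xmin => j; rewrite lgroup_lesubr addrC -lgroup_lesubr lgroup_lesubl.
have := pm (maxn i j); rewrite mulrSr [leRHS]addrC => /le_trans; apply.
have le_gap k : (k <= maxn i j)%N -> x - g (maxn i j) <= x - g k.
  by move=> kij; rewrite lgroup_le2l lgroup_leN2 gnd.
by apply: lgroupD; [apply: le_gap; exact: leq_maxr|
  apply/lgroup_leMn/le_gap; exact: leq_maxl].
Qed.

Hypothesis dsc : dedekind_sigma_complete G.

Lemma seq_sup_exists g b : (forall j, g j <= b) -> exists x, seq_sup g x.
Proof.
move=> gb; have [x [xub xleast]] : supremums (range g) !=set0.
  apply: dsc; first exact: card_image_le.
  by split; [exists (g 0%N); exists 0%N|exists b => _ [j _ <-]].
exists x; split=> [j|c gc]; first by apply: xub; exists j.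
by apply: xleast => _ [j _ <-].
Qed.

(** The supremum [s] of the multiples of [x] satisfies [s <= s - x]. *)
Lemma lgroup_archimedean x b : (forall m, x *+ m <= b) -> x <= 0.
Proof.
move=> /seq_sup_exists[s [sub sleast]].
have : s <= s - x.
  by apply: sleast => j; rewrite lgroup_lesubr -mulrSr; exact: sub.
by rewrite lgroup_lesubr -{2}[s]addr0 lgroup_le2l.
Qed.

End LGroup.

(** * Generic evaluations *)

Section Generic.
Context {R : realType} {G : lGroupType} (u : G).
Implicit Types (a b p q : G) (s : nat -> G) (D : set G).

(** The forcing conditions are the elements [0 < p <= u]; a smaller condition decides more. *)
Definition chain s : Prop :=
  (forall k, 0 < s k <= u) /\ (forall k, s k.+1 <= s k).

Definition dense D : Prop :=
  forall p, 0 < p <= u -> exists q, [/\ 0 < q, q <= p & D q].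

(* [generically Q]: the property [Q] holds along every decreasing sequence
   meeting countably many suitable dense sets, in the sense of forcing. *)
Definition generically (Q : set (nat -> G)) : Prop :=
  exists D : nat -> set G, (forall j, dense (D j)) /\
    forall s, chain s -> (forall j, exists k, D j (s k)) -> Q s.

Lemma chain_ge0 s k : chain s -> 0 <= s k.
Proof. by case=> /(_ k)/andP[/ltW]. Qed.

Lemma chain_le s i j : chain s -> (i <= j)%N -> s j <= s i.
Proof.
move=> [_ sS] /subnK <-; elim: (j - i)%N => // n ih.
by rewrite addSn (le_trans (sS _)).
Qed.

Lemma generically_mono (Q Q' : set (nat -> G)) :
  (forall s, chain s -> Q s -> Q' s) -> generically Q -> generically Q'.
Proof. by move=> QQ' [D [dD DQ]]; exists D; split=> // s cs /DQ; auto. Qed.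

(** Countably many sequences of dense sets are merged into one by decoding pairs; numbers that code
    no pair receive the full set, which is dense. *)
Lemma generically_all (I : countType) (Q : I -> set (nat -> G)) :
  (forall i, generically (Q i)) -> generically (fun s => forall i, Q i s).
Proof.
move=> /choice[D DQ].
exists (fun n => if unpickle n is Some (i, j) then D i j else setT); split.
  move=> n; case: unpickle => [[i j]|]; first exact: (DQ i).1.
  by move=> p /andP[p0 _]; exists p.
move=> s cs sD i; apply: (DQ i).2 => // j.
by have := sD (pickle (i, j)); rewrite pickleK.
Qed.

Lemma generically_and (Q Q' : set (nat -> G)) :
  generically Q -> generically Q' -> generically (fun s => Q s /\ Q' s).
Proof.
move=> gQ gQ'.
have [[]//|D [dD DQ]] := @generically_all bool (fun c => if c then Q else Q').
exists D; split=> // s cs sD; have QQ' := DQ s cs sD.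
by split; [exact: (QQ' true)|exact: (QQ' false)].
Qed.

Lemma generically_dense D : dense D -> generically (fun s => exists k, D (s k)).
Proof. by move=> dD; exists (fun=> D); split=> // s _ /(_ 0%N). Qed.

(** Rasiowa-Sikorski: step [j] of the recursion goes below the current condition into [D j].
    Starting at a prescribed [p] is what later lets generic points refute an inequality. *)
Lemma generically_exists (Q : set (nat -> G)) p : 0 < p <= u -> generically Q ->
  exists s, [/\ chain s, s 0%N = p & Q s].
Proof.
move=> p0u [D [dD DQ]].
have /choice[f fP] : forall x : nat * G, exists q, 0 < x.2 <= u ->
    [/\ 0 < q, q <= x.2 & D x.1 q].
  move=> [j q /=]; have [q0u|nq] := boolP (0 < q <= u).
    by have [q' ?] := dD j q q0u; exists q'.
  by exists q.
pose fix s k := if k is j.+1 then f (j, s j) else p.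
have s0u k : 0 < s k <= u.
  elim: k => //= k ih; have [-> le_s _] := fP (k, s k) ih.
  by case/andP: ih => _; exact: le_trans.
have sP k := fP (k, s k) (s0u k).
have cs : chain s by split=> // k; have [] := sP k.
by exists s; split=> //; apply: DQ => // j; exists j.+1; have [] := sP j.
Qed.

(* In units of [u], the value of [a] at the generic point given by [s]. *)
Definition gen_value s a : R := sup [set r | exists i m k,
  r = i%:R / m.+1%:R /\ le_on (s k) (u *+ i) (a *+ m.+1)].

(** Lower bounds decided along a chain never exceed upper bounds: at a common later index,
    cross-multiplying compares two multiples of [u] on a nonzero condition, and [le_on_unit]
    concludes. *)
Lemma le_on_ratio s a i j m l k k' : chain s ->
  le_on (s k) (u *+ i) (a *+ m.+1) -> le_on (s k') (a *+ l.+1) (u *+ j) ->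
  i%:R / m.+1%:R <= j%:R / l.+1%:R :> R.
Proof.
move=> cs ia aj; rewrite ler_pdivrMr ?ltr0n // mulrAC ler_pdivlMr ?ltr0n //.
rewrite -!natrM ler_nat; pose t := maxn k k'.
have t0 : 0 <= s t by exact: chain_ge0.
apply: (@le_on_unit _ (s t) u); first exact: cs.1.
apply: (@le_on_trans _ _ (a *+ m.+1 *+ l.+1)) => //.
  rewrite mulrnA; apply: le_onMn => //.
  by apply: le_on_sub ia => //; apply: chain_le => //; exact: leq_maxl.
rewrite -mulrnA mulnC !mulrnA; apply: le_onMn => //.
by apply: le_on_sub aj => //; apply: chain_le => //; exact: leq_maxr.
Qed.

Lemma gen_value_ge s a i m k : chain s -> a <= u ->
  le_on (s k) (u *+ i) (a *+ m.+1) -> i%:R <= gen_value s a * m.+1%:R.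
Proof.
move=> cs au ia; rewrite -ler_pdivrMr ?ltr0n //.
apply: ub_le_sup; last by exists i, m, k.
(* Since [a <= u], the ratio 1 bounds the set, so that [sup] is a genuine supremum. *)
exists (1%:R / 1%:R) => _ [j [l [k' [-> ja]]]].
by apply: (le_on_ratio (k' := k') cs ja); rewrite le_le_on ?(chain_ge0 _ cs).
Qed.

Lemma gen_value_le s a i m k : chain s -> 0 <= a ->
  le_on (s k) (a *+ m.+1) (u *+ i) -> gen_value s a * m.+1%:R <= i%:R.
Proof.
move=> cs a0 ai; rewrite -ler_pdivlMr ?ltr0n //; apply: ge_sup.
  exists (0%:R / 1%:R), 0%N, 0%N, 0%N; split=> //.
  by rewrite mulr0n le_le_on ?(chain_ge0 _ cs) ?mulr1n.
by move=> _ [j [l [k' [-> ja]]]]; exact: (le_on_ratio cs ja ai).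
Qed.

Lemma gen_value_mono s a b : chain s -> 0 <= a -> a <= b -> b <= u ->
  gen_value s a <= gen_value s b.
Proof.
move=> cs a0 ab bu; apply: ge_sup.
  exists (0%:R / 1%:R), 0%N, 0%N, 0%N; split=> //.
  by rewrite mulr0n le_le_on ?(chain_ge0 _ cs) ?mulr1n.
move=> _ [j [l [k [-> ja]]]]; rewrite ler_pdivrMr ?ltr0n //.
apply: (gen_value_ge (k := k)) => //.
by apply: le_on_trans ja _;
  rewrite ?(chain_ge0 _ cs) ?le_le_on ?(chain_ge0 _ cs) ?lgroup_leMn.
Qed.

Lemma gen_value0 s : chain s -> 0 <= u -> gen_value s 0 = 0.
Proof.
move=> cs u0; apply/eqP; rewrite eq_le.
have := @gen_value_le s 0 0%N 0 0 cs (lexx 0); rewrite mulr1 => -> /=.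
  by have := @gen_value_ge s 0 0%N 0 0 cs u0; rewrite mulr1 => ->//;
    rewrite mulr0n mulr1n le_le_on ?(chain_ge0 _ cs).
by rewrite mulr0n mulr1n le_le_on ?(chain_ge0 _ cs).
Qed.

Lemma gen_value_unit s : chain s -> 0 <= u -> gen_value s u = 1.
Proof.
move=> cs u0; apply/eqP; rewrite eq_le.
have := @gen_value_le s u 1%N 0 0 cs u0; rewrite mulr1 => -> /=.
  by have := @gen_value_ge s u 1%N 0 0 cs (lexx u); rewrite mulr1 => ->//;
    rewrite le_le_on ?(chain_ge0 _ cs).
by rewrite le_le_on ?(chain_ge0 _ cs).
Qed.

Lemma gen_value_le_on s a b k : chain s -> 0 <= a -> a <= u -> 0 <= b ->
  b <= u -> le_on (s k) a b -> gen_value s a <= gen_value s b.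
Proof.
move=> cs a0 au b0 bu ab; apply: ge_sup.
  exists (0%:R / 1%:R), 0%N, 0%N, 0%N; split=> //.
  by rewrite mulr0n le_le_on ?(chain_ge0 _ cs) ?mulr1n.
move=> _ [j [l [k' [-> ja]]]]; rewrite ler_pdivrMr ?ltr0n //.
have t0 : 0 <= s (maxn k k') by exact: chain_ge0.
apply: (gen_value_ge (k := maxn k k')) => //.
apply: (@le_on_trans _ _ (a *+ l.+1)) => //.
  by apply: le_on_sub ja => //; apply: chain_le => //; exact: leq_maxr.
apply: le_onMn => //.
by apply: le_on_sub ab => //; apply: chain_le => //; exact: leq_maxl.
Qed.

Definition approx s a m i : Prop := exists k,
  le_on (s k) (u *+ i) (a *+ m.+1) && le_on (s k) (a *+ m.+1) (u *+ i.+1).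

(** Given [p] and [m], take the least [i] such that [a *+ m.+1] is at most [u *+ i.+1] on [p]. For
    positive [i], minimality and [not_le_on] give a smaller condition on which [u *+ i] is a lower
    bound. *)
Lemma generically_approx a : 0 <= a -> a <= u ->
  generically (fun s => forall m, exists i, approx s a m i).
Proof.
move=> a0 au; apply: (@generically_all nat) => m.
suff /generically_dense : dense (fun p => exists i,
    le_on p (u *+ i) (a *+ m.+1) && le_on p (a *+ m.+1) (u *+ i.+1)).
  by apply: generically_mono => s _ [k [i ?]]; exists i, k.
move=> p /andP[p0 pu]; have p0' := ltW p0.
have ex : exists i, le_on p (a *+ m.+1) (u *+ i.+1).
  by exists m; rewrite le_le_on // lgroup_leMn.
case: (ex_minnP ex) => -[|i] ai imin.
  exists p; split=> //; exists 0%N; rewrite ai andbT mulr0n le_le_on //.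
  by rewrite -(mul0rn _ m.+1) lgroup_leMn.
have /(not_le_on p0')[q [q0 qp iq]] : ~~ le_on p (a *+ m.+1) (u *+ i.+1).
  by apply/negP => /imin; rewrite ltnn.
exists q; split=> //; exists i.+1; rewrite iq /=.
exact: le_on_sub (ltW q0) qp ai.
Qed.

Lemma approxP s a m i : chain s -> 0 <= a -> a <= u -> approx s a m i ->
  i%:R <= gen_value s a * m.+1%:R <= i.+1%:R.
Proof.
move=> cs a0 au [k /andP[ia ai]].
by rewrite (gen_value_ge cs au ia) (gen_value_le cs a0 ai).
Qed.

Lemma le0_mulSn (x c : R) : (forall m, x * m.+1%:R <= c) -> x <= 0.
Proof.
move=> xc; rewrite leNgt; apply/negP => x0.
have c0 : 0 <= c by have := xc 0%N; rewrite mulr1; apply: le_trans; exact: ltW.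
have := xc (Num.truncn (c / x)); rewrite leNgt => /negP; apply.
rewrite mulrC -ltr_pdivrMr //; exact: truncnS_gt.
Qed.

(** Bounds decided for [a] and [b] add up at a common index. After scaling by [m.+1] the two sides
    thus differ by at most 2, whatever [m] is. *)
Lemma gen_valueD a b : 0 <= a -> 0 <= b -> a + b <= u ->
  generically (fun s => gen_value s (a + b) = gen_value s a + gen_value s b).
Proof.
move=> a0 b0 abu.
have au : a <= u by rewrite (le_trans _ abu) // -[leLHS]addr0 lgroup_le2l.
have bu : b <= u by rewrite (le_trans _ abu) // -[leLHS]add0r lgroup_le2r.
have ab0 := lgroup_addr_ge0 a0 b0.
apply: generically_mono (generically_and (generically_approx a0 au)
  (generically_and (generically_approx b0 bu) (generically_approx ab0 abu))).
move=> s cs [aa [ab aab]].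
suff key m : `|(gen_value s (a + b) - (gen_value s a + gen_value s b)) *
    m.+1%:R| <= 2.
  apply/eqP; rewrite eq_le -subr_le0 -[X in _ && X]subr_le0.
  apply/andP; split; apply: (@le0_mulSn _ 2) => m; apply: le_trans (key m).
    exact: ler_norm.
  by rewrite -normrN -mulNr opprB ler_norm.
have [i ai] := aa m; have [j bj] := ab m; have [l abl] := aab m.
have /andP[i1 i2] := approxP cs a0 au ai; have /andP[j1 j2] := approxP cs b0 bu bj.
have /andP[l1 l2] := approxP cs ab0 abu abl.
have [k1 /andP[ia ai']] := ai; have [k2 /andP[jb bj']] := bj.
pose t := maxn k1 k2; have t0 : 0 <= s t by exact: chain_ge0.
have tk1 : s t <= s k1 by apply: chain_le => //; exact: leq_maxl.
have tk2 : s t <= s k2 by apply: chain_le => //; exact: leq_maxr.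
have lo : (i + j)%:R <= gen_value s (a + b) * m.+1%:R.
  apply: (gen_value_ge (k := t)) => //; rewrite mulrnDr mulrnDl.
  by apply: le_onD => //; [exact: le_on_sub ia|exact: le_on_sub jb].
have hi : gen_value s (a + b) * m.+1%:R <= (i.+1 + j.+1)%:R.
  apply: (gen_value_le (k := t)) => //; rewrite mulrnDr mulrnDl.
  by apply: le_onD => //; [exact: le_on_sub ai'|exact: le_on_sub bj'].
move: i1 i2 j1 j2 lo hi; rewrite !natrD !mulrSr !mulr0n ler_norml => *.
by apply/andP; split; lra.
Qed.

(** Densely many conditions decide which of [a] and [b] is the smaller; on such a condition that
    element is also below the meet. *)
Lemma gen_value_meet a b : 0 <= a -> a <= u -> 0 <= b -> b <= u ->
  generically (fun s =>
    gen_value s (lmeet a b) = Num.min (gen_value s a) (gen_value s b)).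
Proof.
move=> a0 au b0 bu.
have m0 : 0 <= lmeet a b by rewrite lmeet_ge0.
have mu : lmeet a b <= u by rewrite (le_trans (ge_lmeetl _ _)).
have /generically_dense : dense (fun p => le_on p a b || le_on p b a).
  move=> p /andP[p0 pu]; have [ab|] := boolP (le_on p a b).
    by exists p; rewrite ab.
  by move=> /(not_le_on (ltW p0))[q [q0 qp ba]]; exists q; rewrite ba orbT.
apply: generically_mono => s cs [k abba].
have sk0 := chain_ge0 k cs; apply/eqP; rewrite eq_le le_min.
rewrite !gen_value_mono ?ge_lmeetl ?ge_lmeetr //= ge_min.
apply/orP; case/orP: abba => [ab|ba]; [left|right].
  exact: (gen_value_le_on cs a0 au m0 mu (le_on_meet sk0 ab)).
apply: (gen_value_le_on cs b0 bu m0 mu (k := k)).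
by rewrite lmeetC le_on_meet.
Qed.

(** For each [m], densely many conditions satisfy [(a - g j) *+ m <= u] for some [j]; otherwise some
    [p > 0] would lie below all these multiples, against [seq_sup_gap]. Generically, [g j] thus
    comes arbitrarily close in value to [a]. *)
Lemma gen_value_sup g a : (forall i j, (i <= j)%N -> g i <= g j) ->
  (forall j, 0 <= g j) -> a <= u -> seq_sup g a ->
  generically (fun s => forall r, r < gen_value s a ->
    exists j, r < gen_value s (g j)).
Proof.
move=> gnd g0 au ga; have a0 : 0 <= a := le_trans (g0 0%N) (ga.1 0%N).
have gu j : g j <= u := le_trans (ga.1 j) au.
have gap m : generically (fun s => exists k, exists j,
    le_on (s k) ((a - g j) *+ m) u).
  apply: (generically_dense (D := fun p => exists j, le_on p ((a - g j) *+ m) u)).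
  move=> p /andP[p0 pu]; apply: contrapT => noq.
  have : p <= 0; last by move=> /le_gtF; rewrite p0.
  apply: (seq_sup_gap (m := m) gnd ga) => j.
  set h := (a - g j) *+ m.
  have h0 : 0 <= h by rewrite -(mul0rn _ m) lgroup_leMn // lgroup_subr_ge0 ga.1.
  have [q0|qn0] := eqVneq (lmeet p (lpos (u - h))) 0; last first.
    case: noq; exists (lmeet p (lpos (u - h))).
    have qge0 : 0 <= lmeet p (lpos (u - h)) by rewrite lmeet_ge0 ?lpos_ge0 ?ltW.
    split; rewrite ?ge_lmeetl ?lt_def ?qn0 //.
    by exists j; apply: le_on_lpos => //; exact: ge_lmeetr.
  (* Here [p <= u <= lpos (u - h) + h], and [p] is disjoint from the first summand, so [p <= h]. *)
  apply: (@le_trans _ _ (lmeet p (lpos (u - h) + h))).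
    by rewrite le_lmeet lexx (le_trans pu) // -lgroup_lesubl le_lpos.
  apply: le_trans (lmeetDr_le (ltW p0) (lpos_ge0 _) h0) _.
  by rewrite q0 add0r ge_lmeetr.
have := generically_and (@generically_all nat _ gap)
  (@generically_all nat _ (fun j => generically_approx (g0 j) (gu j))).
apply: generically_mono => s cs [gaps approxs] r ra.
have : ~ gen_value s a - r <= 0.
  by rewrite subr_le0 => /(lt_le_trans ra); rewrite ltxx.
move=> nle; apply: contrapT => nex; apply: nle; apply: (@le0_mulSn _ 2) => m.
have [k [j gapj]] := gaps m.+1; have [i gi] := approxs j m.
have /andP[i1 i2] := approxP cs (g0 j) (gu j) gi.
have gr : gen_value s (g j) <= r.
  by rewrite leNgt; apply/negP => ?; apply: nex; exists j.
have [k' /andP[_ gi']] := gi.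
pose t := maxn k k'; have t0 : 0 <= s t by exact: chain_ge0.
have tk : s t <= s k by apply: chain_le => //; exact: leq_maxl.
have tk' : s t <= s k' by apply: chain_le => //; exact: leq_maxr.
have hi : gen_value s a * m.+1%:R <= i.+2%:R.
  apply: (gen_value_le (k := t)) => //; rewrite [u *+ _]mulrSr -[a](subrK (g j)).
  rewrite mulrnDl addrC; apply: le_onD => //; first exact: le_on_sub gi'.
  exact: le_on_sub gapj.
have : gen_value s (g j) * m.+1%:R <= r * m.+1%:R by rewrite ler_wpM2r.
move: i1 i2 hi; rewrite mulrBl !mulrSr => *; lra.
Qed.

Hypothesis dsc : dedekind_sigma_complete G.

(** By the Archimedean property, a failure of [a <= b] yields an [m] with [(a - b) *+ m] not below
    [u]. The excess [y] meets [u] in a condition [p] on which [u + b *+ m] is at most [a *+ m], and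
    a generic sequence from [p] gives [a] a larger value than [b]. *)
Lemma gen_value_le_imp a b : 0 <= a -> a <= u -> 0 <= b -> b <= u ->
  generically (fun s => gen_value s a <= gen_value s b) -> a <= b.
Proof.
move=> a0 au b0 bu gab; have u0 := le_trans a0 au.
rewrite -[b]add0r -lgroup_lesubl; apply: (lgroup_archimedean dsc (b := u)) => m.
have [//|nle] := boolP ((a - b) *+ m <= u); exfalso.
set y := lpos ((a - b) *+ m - u).
have y0 : 0 <= y := lpos_ge0 _.
have [uy|uyn0] := eqVneq (lmeet u y) 0.
  (* If [y] were disjoint from [u], it would be disjoint from [u *+ m], which dominates it, hence
     zero. *)
  have yu : y <= u *+ m.
    rewrite ljoin_le -(mul0rn _ m) lgroup_leMn // andbT lgroup_lesubl.
    rewrite -[leLHS]addr0 lgroupD // lgroup_leMn // lgroup_lesubl.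
    by rewrite -[leLHS]addr0 lgroupD.
  have yE : y = 0.
    have /(lmeet_eq0_mulrn m y0 u0) : lmeet y u = 0 by rewrite lmeetC.
    by move/lmeet_idPl: yu => ->.
  by move: nle; rewrite -lgroup_subr_ge0 -lgroup_leN2 opprB oppr0 -{1}yE le_lpos.
pose p := lmeet u y.
have pge0 : 0 <= p by rewrite lmeet_ge0.
have p0u : 0 < p <= u by rewrite lt_def uyn0 pge0 ge_lmeetl.
have [s [cs s0 [vab [sb _]]]] := generically_exists p0u
  (generically_and gab (generically_and (generically_approx b0 bu)
    (generically_approx a0 au))).
have on_p : le_on p (u + b *+ m) (a *+ m).
  apply: le_on_lpos => //; apply: le_trans (ge_lmeetr _ _) _.
  by rewrite /y mulrnBl opprD [- u + _]addrC addrA.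
case: m nle y y0 uyn0 p pge0 p0u s0 on_p => [|m]; first by rewrite mulr0n u0.
move=> _ y y0 uyn0 p pge0 p0u s0 on_p.
(* With the doubled denominator the gain [u] becomes [u *+ 2], more than the uncertainty of one [u]
   left on the value of [b]. *)
have [i bi] := sb (m.+1 * 2).-1.
have /andP[i1 i2] := approxP cs b0 bu bi; have [k /andP[ib _]] := bi.
have mE : ((m.+1 * 2).-1.+1 = m.+1 * 2)%N by rewrite prednK // muln_gt0.
have sk0 := chain_ge0 k cs; rewrite mE in i2 ib.
have : i.+2%:R <= gen_value s a * (m.+1 * 2).-1.+1%:R :> R.
  apply: (gen_value_ge (k := k)) => //; rewrite mE.
  apply: (@le_on_trans _ _ ((u + b *+ m.+1) *+ 2)) => //.
    by rewrite mulrnDl -mulrnA -addn2 mulrnDr addrC; apply: le_onD => //;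
      rewrite le_le_on.
  rewrite mulrnA; apply: le_onMn => //.
  by apply: le_on_sub on_p => //; rewrite -s0; exact: chain_le.
rewrite mE => /le_trans /(_ (ler_wpM2r (ler0n _ _) vab)) /le_trans /(_ i2).
by rewrite ler_nat ltnn.
Qed.

End Generic.

(** * Orthants generate the Borel sets *)

Section BorelOrthants.
Context {R : realType} {n : nat}.
Implicit Types (s : 'I_n -> R) (A : set 'rV[R]_n).

Definition orthants : set (set 'rV[R]_n) := range (@lower_orthant R n).

Lemma open_lower_orthant s : open (lower_orthant s).
Proof.
rewrite openE => v vs; rewrite /interior /=.
suff : nbhs v (fun w : 'rV[R]_n => forall i, w ord0 i < s i) by [].
apply: (@filter_forall _ _ (fun i (w : 'rV[R]_n) => w ord0 i < s i) (nbhs v) _).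
move=> i.
have op : open ((fun w : 'rV[R]_n => w ord0 i) @^-1` [set t | t < s i]).
  by apply: open_comp (@open_lt R (s i)) => w _; exact: coord_continuous.
by apply: (open_nbhs_nbhs (conj op _)); exact: vs.
Qed.

Lemma orthants_setI : setI_closed orthants.
Proof.
move=> _ _ [s _ <-] [t _ <-]; exists (fun i => Num.min (s i) (t i)) => //.
apply/seteqP; split=> v /= vst.
  by split=> i; have := vst i; rewrite lt_min => /andP[].
by move=> i; rewrite lt_min vst.1 vst.2.
Qed.

Let T := g_sigma_algebraType orthants.

Let half_measurable (i : 'I_n) (b : R) :
  measurable ([set v : 'rV[R]_n | v ord0 i < b] : set T).
Proof.
have -> : [set v : 'rV[R]_n | v ord0 i < b] = \bigcup_k
    lower_orthant (fun j => if j == i then b else k%:R).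
  apply/seteqP; split=> [v /= vb|v [k _ /(_ i)]]; last by rewrite eqxx.
  exists (Num.truncn (\sum_j `|v ord0 j|)).+1 => // j.
  case: eqP => [->//|_]; apply: le_lt_trans (truncnS_gt _).
  rewrite (le_trans (ler_norm _)) // (bigD1 j) //= lerDl.
  by rewrite sumr_ge0.
apply: bigcupT_measurable => k; apply: sub_sigma_algebra; by eexists.
Qed.

(** Half-open cubes are finite intersections of differences of half-spaces [v ord0 i < b]; rational
    centres and radii [1/(m+1)] make the family countable. *)
Definition rat_cube (c : 'rV[rat]_n * nat) : set 'rV[R]_n :=
  [set v | forall i, ratr (c.1 ord0 i) - c.2.+1%:R^-1 <= v ord0 i
                     < ratr (c.1 ord0 i) + c.2.+1%:R^-1].

Let rat_cube_measurable c : measurable (rat_cube c : set T).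
Proof.
have -> : rat_cube c = \bigcap_(i in [set: 'I_n])
   ([set v : 'rV[R]_n | v ord0 i < ratr (c.1 ord0 i) + c.2.+1%:R^-1] `\`
    [set v : 'rV[R]_n | v ord0 i < ratr (c.1 ord0 i) - c.2.+1%:R^-1]).
  apply/seteqP; split=> v /= vc i; first move=> _.
    by have /andP[vl vr] := vc i; split=> //; apply/negP; rewrite -leNgt.
  by have [vr /negP] := vc i I; rewrite -leNgt => ->.
apply: (@fin_bigcap_measurable _ T); first exact: finite_finset.
by move=> i _; apply: (@measurableD _ T); exact: half_measurable.
Qed.

Lemma open_bigcup_rat_cube A : open A ->
  A = \bigcup_(c in [set c | rat_cube c `<=` A]) rat_cube c.
Proof.
move=> oA; apply/seteqP; split=> [v Av|v [c /= cA /cA//]].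
have /nbhs_ballP[e /= e0 eA] : nbhs v A by exact: open_nbhs_nbhs.
pose m := Num.truncn (2 / e).
have me : 2 * m.+1%:R^-1 < e.
  by rewrite ltr_pdivrMr ?ltr0n // mulrC -ltr_pdivrMr // truncnS_gt.
have m0 : 0 < m.+1%:R^-1 :> R by rewrite invr_gt0 ltr0n.
(* The centre is within one radius of [v], so the cube contains [v] and its points are within two
   radii, less than [e], of [v]. *)
have /choice[q qP] : forall i, exists q : rat,
    ratr q \in `]v ord0 i - m.+1%:R^-1, v ord0 i[.
  by move=> i; apply: rat_in_itvoo; rewrite ltrBlDr ltrDl.
exists (\row_i q i, m) => [w /= wc|i].
  apply: eA; split=> // k i.
  have -> : k = ord0 by rewrite ord1; exact: val_inj.
  move: (wc i) (qP i); rewrite mxE in_itv /= => /andP[w1 w2] /andP[q1 q2].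
  move: me w1 w2 q1 q2; move: (m.+1%:R^-1 : R) => z me w1 w2 q1 q2.
  by rewrite /ball /= ltr_norml; apply/andP; split; lra.
move: (qP i); rewrite /= mxE in_itv /= => /andP[q1 q2].
by apply/andP; split; move: q1 q2; move: (m.+1%:R^-1 : R) => z; lra.
Qed.

Lemma borel_orthants : @borel 'rV[R]_n = <<s orthants>>.
Proof.
apply/seteqP; split; apply: smallest_sub; try exact: smallest_sigma_algebra.
  move=> A /open_bigcup_rat_cube ->; rewrite bigcup_mkcond.
  apply: (@countable_bigcupT_measurable _ T); first exact: countableP.
  by move=> c; case: ifP => _; [exact: rat_cube_measurable|exact: measurable0].
move=> _ [s _ <-]; apply: sub_sigma_algebra; exact: open_lower_orthant.
Qed.

Lemma orthant_pi_lambda (H : set (set 'rV[R]_n)) :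
  lambda_system setT H -> orthants `<=` H -> @borel 'rV[R]_n `<=` H.
Proof.
move=> lH oH; rewrite borel_orthants.
by apply: lambda_system_subset => //; exact: orthants_setI.
Qed.

End BorelOrthants.

(** * Real comonotone laws *)

Section Quantile.
Context {R : realType} {n : nat} (F : 'I_n -> R -> R).
Implicit Types (A B : set 'rV[R]_n) (s : 'I_n -> R).

(** Coordinatewise generalized inverse of [F]. Outside []0, 1[] the infimum may be over an empty or
    unbounded set, whence the restriction in [quantile_set]. *)
Definition quantile (w : R) : 'rV[R]_n := \row_i inf [set t | w < F i t].

Definition quantile_set A : set R :=
  [set w | 0 < w < 1 /\ A (quantile w)].

(* Law of the random vector with marginals [F i] whose coordinates are
   nondecreasing functions of one uniform variable. *)
Definition comonotone_law A : R := fine (lebesgue_measure (quantile_set A)).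

(** Left continuity is left out: it amounts to one supremum for each real [t], whereas a generic
    sequence respects only countably many. It is assumed only at the corner in
    [comonotone_law_orthant]. *)
Definition cdf_family : Prop :=
  [/\ forall i a b, a <= b -> F i a <= F i b,
      forall i t, F i t <= 1,
      forall i r, 0 < r -> exists t, F i t < r
    & forall i r, r < 1 -> exists t, r < F i t].

Hypothesis cdfF : cdf_family.

Lemma quantile_lt (w : R) i c : 0 < w < 1 ->
  quantile w ord0 i < c <-> exists2 t, w < F i t & t < c.
Proof.
case: cdfF => Fnd _ F0 F1 /andP[w0 w1]; rewrite mxE.
have [t wt] := F1 i w w1; have [b bw] := F0 i w w0.
split=> [/inf_lt|[t' wt' t'c]]; first by apply; exists t.
apply: le_lt_trans t'c; apply: ge_inf => //; exists b => x /= wx.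
rewrite leNgt; apply/negP => /ltW /(Fnd i) xb.
by have := lt_trans (lt_le_trans wx xb) bw; rewrite ltxx.
Qed.

Lemma measurable_quantile_set A : borel A -> measurable (quantile_set A).
Proof.
rewrite borel_orthants; pose H := [set A | measurable (quantile_set A)].
suff : <<s orthants>> `<=` H by exact.
apply: smallest_sub.
  split=> [|B|B] /=.
  - rewrite /H /= (_ : quantile_set set0 = set0) //.
    by apply/seteqP; split=> // w [].
  - rewrite /H /= => mB.
    rewrite (_ : quantile_set _ = [set` `]0, 1[%R] `\` quantile_set B).
      exact: measurableD.
    apply/seteqP; split=> w; rewrite /quantile_set /= in_itv /=.
      by move=> [w01 [_ nB]]; split=> // -[].
    by move=> [w01 nB]; split=> //; split=> // Bw; exact: nB.
  - rewrite /H /= => mB.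
    rewrite (_ : quantile_set _ = \bigcup_i quantile_set (B i)).
      exact: bigcupT_measurable.
    apply/seteqP; split=> w; first by move=> [w01 [i _ Bw]]; exists i.
    by move=> [i _ [w01 Bw]]; split=> //; exists i.
(* Quantiles are nondecreasing in [w], so the preimage of an orthant is an interval. *)
move=> _ [s _ <-]; apply: is_interval_measurable => x y [/andP[x0 _] _].
move=> [/andP[y0 y1] yq] z /andP[xz zy].
have z01 : 0 < z < 1 by rewrite (lt_le_trans x0) //= (le_lt_trans zy).
split=> // i; have := yq i; rewrite !quantile_lt ?y0 //.
by move=> [t yt ts]; exists t => //; exact: le_lt_trans yt.
Qed.

Lemma lebesgue_quantile_set A : borel A ->
  lebesgue_measure (quantile_set A) = (comonotone_law A)%:E.
Proof.
move=> bA; rewrite /comonotone_law fineK // ge0_fin_numE //.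
apply: (@le_lt_trans _ _ (lebesgue_measure ([set` `]0, 1[%R] : set R))).
  rewrite le_measure ?inE //; first exact: measurable_quantile_set.
  by move=> w [w01 _]; rewrite /= in_itv.
by rewrite lebesgue_measure_itv /= lte01 sube0 ltry.
Qed.

Lemma comonotone_law_ge0 A : 0 <= comonotone_law A.
Proof. exact: fine_ge0. Qed.

Lemma comonotone_lawT : comonotone_law setT = 1.
Proof.
rewrite /comonotone_law (_ : quantile_set setT = [set` `]0, 1[%R]).
  by rewrite lebesgue_measure_itv /= lte01 sube0.
by apply/seteqP; split=> w; rewrite /quantile_set /= in_itv /= => // -[].
Qed.

Lemma comonotone_lawU A B : borel A -> borel B -> borel (A `|` B) ->
  A `&` B = set0 ->
  comonotone_law (A `|` B) = comonotone_law A + comonotone_law B.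
Proof.
move=> bA bB bAB AB0; apply: EFin_inj; rewrite EFinD -!lebesgue_quantile_set //.
rewrite -measureU; first last.
- apply/seteqP; split=> // w [[_ Aw] [_ Bw]].
  by have : (A `&` B) (quantile w) by []; rewrite AB0.
- exact: measurable_quantile_set.
- exact: measurable_quantile_set.
congr lebesgue_measure; apply/seteqP; split=> w.
  by move=> [w01 [Aw|Bw]]; [left|right].
by move=> [[w01 Aw]|[w01 Bw]]; split=> //; [left|right].
Qed.

Lemma comonotone_law_bigcup (A : nat -> set 'rV[R]_n) (r : R) :
  (forall i, borel (A i)) -> borel (\bigcup_i A i) ->
  (forall i, A i `<=` A i.+1) ->
  r < comonotone_law (\bigcup_i A i) -> exists i, r < comonotone_law (A i).
Proof.
move=> bA bU And rU; apply: contrapT => nex.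
have UE : \bigcup_i quantile_set (A i) = quantile_set (\bigcup_i A i).
  apply/seteqP; split=> w; first by move=> [i _ [w01 Bw]]; split=> //; exists i.
  by move=> [w01 [i _ Bw]]; exists i.
have : (lebesgue_measure (quantile_set (\bigcup_i A i)) <= r%:E)%E.
  rewrite -UE.
  have cvg : lebesgue_measure (quantile_set (A i)) @[i --> \oo] -->
      lebesgue_measure (\bigcup_i quantile_set (A i)).
    apply: nondecreasing_cvg_mu.
    - by move=> i; exact: measurable_quantile_set.
    - by rewrite UE; exact: measurable_quantile_set.
    - apply: homo_leq => [B|B C D|i]; [exact: lexx|exact: le_trans|].
      by rewrite subsetEset => w [w01 Aw]; split=> //; exact: And.
  rewrite -(cvg_lim _ cvg) //; apply: lime_le.
    by apply/cvg_ex; eexists; exact: cvg.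
  apply: nearW => i; rewrite lebesgue_quantile_set // lee_fin leNgt.
  by apply/negP => rA; apply: nex; exists i.
by rewrite lebesgue_quantile_set // lee_fin leNgt rU.
Qed.

(** By left continuity at [s i], coordinate [i] of the quantile is below [s i] exactly when
    [w < F i (s i)], so the quantile set is []0, m[]. *)
Lemma comonotone_law_orthant s :
  (forall i r, r < F i (s i) -> exists2 t, r < F i t & t < s i) ->
  (forall i, 0 <= F i (s i)) ->
  comonotone_law (lower_orthant s) = \big[Num.min/1]_(i < n) F i (s i).
Proof.
case: cdfF => Fnd Fle1 _ _ Fleft F0; set m := \big[_/_]_(i < n) _.
have m0 : 0 <= m.
  by rewrite /m; elim/big_ind: _ => // x y ? ?; rewrite le_min; apply/andP.
have m1 : m <= 1.
  by rewrite /m; elim/big_ind: _ => // x y x1 _; rewrite ge_min x1.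
rewrite /comonotone_law (_ : quantile_set _ = [set` `]0, m[%R]).
  rewrite lebesgue_measure_itv /= lte_fin; move: m0.
  by rewrite le_eqVlt => /predU1P[<-|->]; rewrite ?ltxx //= subr0.
apply/seteqP; split=> w; rewrite /quantile_set /= in_itv /=.
  move=> [w01 ws]; case/andP: (w01) => -> w1 /=.
  rewrite /m; elim/big_ind: _ => //; first by move=> x y; rewrite lt_min => -> ->.
  move=> i _; have [t wt /ltW /(Fnd i)] := (quantile_lt i (s i) w01).1 (ws i).
  exact: lt_le_trans.
move=> /andP[w0 wm]; have w01 : 0 < w < 1 by rewrite w0 (lt_le_trans wm).
split=> // i; rewrite quantile_lt //; apply: Fleft; apply: lt_le_trans wm _.
by rewrite /m (bigD1 i) //= ge_min lexx.
Qed.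

End Quantile.

(** * Comonotone laws with values in a lattice-ordered group *)

Section BorelSets.
Context {T : topologicalType}.
Implicit Types A B : set T.

Let borel_sigma_algebra : sigma_algebra setT (@borel T) :=
  smallest_sigma_algebra setT open.

Lemma borelC A : borel A -> borel (~` A).
Proof. by case: borel_sigma_algebra => _ bC _ /bC; rewrite setTD. Qed.

Lemma borelT : borel [set: T].
Proof. by rewrite -setC0; apply: borelC; case: borel_sigma_algebra. Qed.

Lemma borel_bigcup (F : nat -> set T) :
  (forall i, borel (F i)) -> borel (\bigcup_i F i).
Proof. by case: borel_sigma_algebra => _ _; apply. Qed.

Lemma borelU A B : borel A -> borel B -> borel (A `|` B).
Proof.
move=> bA bB; rewrite -bigcup2E; apply: borel_bigcup => -[|[|i]] //=.
by case: borel_sigma_algebra.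
Qed.

Lemma borelD A B : borel A -> borel B -> borel (A `\` B).
Proof.
move=> bA bB; rewrite setDE -[A]setCK -setCU; apply: borelC.
by apply: borelU => //; exact: borelC.
Qed.

End BorelSets.

Section JointLaw.
Context {R : realType} {G : lGroupType} (dsc : dedekind_sigma_complete G).
Context (u : G) (u0 : 0 <= u) {n : nat} (f : 'I_n -> R -> G).
Implicit Types (A B : set 'rV[R]_n) (s : nat -> G).

Hypothesis fnd : forall i a b, a <= b -> f i a <= f i b.
Hypothesis f0 : forall i t, 0 <= f i t.
Hypothesis fu : forall i t, f i t <= u.
Hypothesis fleft : forall i t, seq_sup (fun k => f i (t - k.+1%:R^-1)) (f i t).
Hypothesis ftop : forall i, seq_sup (fun k => f i k%:R) u.
Hypothesis fbot : forall i, seq_sup (fun k => u - f i (- k%:R)) u.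

Let F s i t : R := gen_value u s (f i t).
Let law s A : R := comonotone_law (F s) A.

(** Monotonicity and the bound 1 hold along every chain. The limits need suprema over the integers
    only; the one at minus infinity passes through [u - f i (- k)] and additivity. *)
Lemma generically_cdf_family : generically u (fun s => cdf_family (F s)).
Proof.
have top i := gen_value_sup (R := R)
  (fun k l (kl : (k <= l)%N) => fnd i (etrans (ler_nat R k l) kl))
  (fun k => f0 i k%:R) (lexx u) (ftop i).
have bot i : generically u (fun s => forall r : R, r < gen_value u s u ->
    exists k, r < gen_value u s (u - f i (- k%:R))).
  apply: gen_value_sup (fbot i) => //.
    by move=> k l kl; rewrite lgroup_le2l lgroup_leN2 fnd // lerN2 ler_nat.
  by move=> k; rewrite lgroup_subr_ge0.
have compl i : generically u (fun s => forall k, gen_value u s u =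
    gen_value u s (u - f i (- k%:R)) + gen_value u s (f i (- k%:R)) :> R).
  apply: (@generically_all _ _ nat) => k.
  have := @gen_valueD R _ u (u - f i (- k%:R)) (f i (- k%:R)).
  by rewrite subrK; apply; rewrite // lgroup_subr_ge0.
apply: generically_mono (@generically_all _ _ 'I_n _
  (fun i => generically_and (top i) (generically_and (bot i) (compl i)))).
move=> s cs H; rewrite /F; split.
- by move=> i a b ab; apply: gen_value_mono => //; exact: fnd.
- by move=> i t; rewrite -(gen_value_unit (R := R) cs u0); exact: gen_value_mono.
- move=> i r r0; have [_ [H1 H2]] := H i.
  have [|k rk] := H1 (1 - r); first by rewrite gen_value_unit // gtrBl.
  exists (- k%:R); have := H2 k; rewrite gen_value_unit // => ?; lra.
- move=> i r r1; have [Ht _] := H i.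
  have [|k rk] := Ht r; first by rewrite gen_value_unit.
  by exists k%:R.
Qed.

(** The dense sets may depend on [A], so each argument may involve only countably many sets at
    once. *)
Definition lifts_law A (a : G) : Prop :=
  0 <= a <= u /\ generically u (fun s => gen_value u s a = law s A).

(** Monotonicity of the real laws passes to [G] because generic values determine the order. With
    [A = B] it gives uniqueness of the lift. *)
Lemma lifts_law_mono A B a b : borel A -> borel B -> A `<=` B ->
  lifts_law A a -> lifts_law B b -> a <= b.
Proof.
move=> bA bB AB [/andP[a0 au] Aa] [/andP[b0 bu] Bb].
apply: (gen_value_le_imp (R := R) dsc a0 au b0 bu).
apply: generically_mono
  (generically_and generically_cdf_family (generically_and Aa Bb)).
move=> s cs [cdf [-> ->]]; rewrite /law -(setDUK AB) comonotone_lawU //.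
- by rewrite lerDl comonotone_law_ge0.
- exact: borelD.
- by rewrite setDUK.
- by rewrite setDE setICA setICr setI0.
Qed.

Lemma lifts_lawT : lifts_law setT u.
Proof.
split; first by rewrite u0 lexx.
apply: generically_mono generically_cdf_family => s cs cdf.
by rewrite gen_value_unit // /law comonotone_lawT.
Qed.

Lemma lifts_lawD A B a b : borel A -> borel B -> B `<=` A ->
  lifts_law A a -> lifts_law B b -> lifts_law (A `\` B) (a - b).
Proof.
move=> bA bB BA Aa Bb; have ba := lifts_law_mono bB bA BA Bb Aa.
case: Aa Bb => [/andP[a0 au] Aa] [/andP[b0 bu] Bb].
have ab0 : 0 <= a - b by rewrite lgroup_subr_ge0.
have abu : a - b <= u.
  by rewrite lgroup_lesubl (le_trans au) // -[leLHS]addr0 lgroup_le2l.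
split; first by rewrite ab0.
have := @gen_valueD R _ u (a - b) b ab0 b0; rewrite subrK => /(_ au) add.
apply: generically_mono (generically_and generically_cdf_family
  (generically_and add (generically_and Aa Bb))).
move=> s cs [cdf [addE [vA vB]]]; apply: (addIr (law s B)).
rewrite -{1}vB -addE vA /law addrC -comonotone_lawU //.
- by rewrite setDUK.
- exact: borelD.
- by rewrite setDUK.
- by rewrite setDE setICA setICr setI0.
Qed.

Lemma lifts_law_bigcup (A : nat -> set 'rV[R]_n) (a : nat -> G) b :
  (forall i, borel (A i)) -> (forall i, A i `<=` A i.+1) ->
  (forall i, lifts_law (A i) (a i)) -> seq_sup a b ->
  lifts_law (\bigcup_i A i) b.
Proof.
move=> bA And Aa ab.
have and' i j : (i <= j)%N -> a i <= a j.
  apply: (homo_leq (r := fun x y : G => x <= y)) => [|? ? ?|k];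
    [exact: lexx|exact: le_trans|].
  exact: lifts_law_mono (And k) (Aa k) (Aa k.+1).
have a0 i : 0 <= a i by case: (Aa i) => /andP[].
have bu : b <= u by apply: ab.2 => i; case: (Aa i) => /andP[].
have b0 : 0 <= b := le_trans (a0 0%N) (ab.1 0%N).
split; first by rewrite b0.
apply: generically_mono (generically_and generically_cdf_family
  (generically_and (gen_value_sup (R := R) and' a0 bu ab)
    (@generically_all _ _ nat _ (fun i => (Aa i).2)))).
move=> s cs [cdf [sup_b vA]]; apply/eqP; rewrite eq_le; apply/andP; split.
  rewrite leNgt; apply/negP => /sup_b[i]; rewrite vA ltNge => /negP; apply.
  rewrite /law -(setDUK (@bigcup_sup _ _ i setT A I)) comonotone_lawU //.
  - by rewrite lerDl comonotone_law_ge0.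
  - by apply: borelD => //; exact: borel_bigcup.
  - by rewrite setDUK; [exact: borel_bigcup|exact: bigcup_sup].
  - by rewrite setDE setICA setICr setI0.
rewrite leNgt; apply/negP => /(comonotone_law_bigcup cdf bA (borel_bigcup bA) And)[i].
rewrite -/(law s (A i)) -vA ltNge => /negP; apply.
by apply: gen_value_mono => //; exact: ab.1.
Qed.

(** Only finitely many binary meets and the left limits at the [c i] have to be respected, so one
    generic condition covers them. *)
Lemma lifts_law_orthant (c : 'I_n -> R) :
  lifts_law (lower_orthant c) (\big[lmeet/u]_(i < n) f i (c i)).
Proof.
have meetP (P : pred 'I_n) (r : seq 'I_n) :
    0 <= \big[lmeet/u]_(i <- r | P i) f i (c i) <= u.
  elim/big_rec: _ => [|i x _ /andP[x0 xu]]; first by rewrite u0 lexx.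
  by rewrite lmeet_ge0 //= (le_trans (ge_lmeetr _ _)).
split; first exact: meetP.
have left i : generically u (fun s => forall r, r < F s i (c i) ->
    exists k, r < F s i (c i - k.+1%:R^-1)).
  apply: gen_value_sup (fleft i (c i)) => // k l kl.
  by rewrite fnd // lerD2l lerN2 lef_pV2 ?posrE ?ltr0n // ler_nat.
have meet (r : seq 'I_n) : generically u (fun s =>
    gen_value u s (\big[lmeet/u]_(i <- r) f i (c i)) =
    \big[Num.min/1]_(i <- r) F s i (c i)).
  elim: r => [|i r ih].
    apply: generically_mono generically_cdf_family => s cs _.
    by rewrite !big_nil gen_value_unit.
  have /andP[r0 ru] := meetP xpredT r.
  apply: generically_mono (generically_and ih
    (gen_value_meet (R := R) (f0 i (c i)) (fu i (c i)) r0 ru)).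
  by move=> s cs [ihs ms]; rewrite !big_cons ms ihs.
apply: generically_mono (generically_and generically_cdf_family
  (generically_and (@generically_all _ _ 'I_n _ left)
    (meet (index_enum 'I_n)))).
move=> s cs [cdf [lefts ->]]; rewrite /law comonotone_law_orthant //.
  move=> i r /lefts[k rk]; exists (c i - k.+1%:R^-1) => //.
  by rewrite gtrBl invr_gt0 ltr0n.
by move=> i; rewrite /F -(gen_value0 (R := R) cs u0); exact: gen_value_mono.
Qed.

Lemma lifts_law_exists A : borel A -> exists a, lifts_law A a.
Proof.
pose H := [set A | borel A /\ exists a, lifts_law A a].
suff : @borel 'rV[R]_n `<=` H by move=> bH /bH[].
apply: orthant_pi_lambda; last first.
  move=> _ [c _ <-]; split; last by eexists; exact: lifts_law_orthant.
  by apply: sub_sigma_algebra; exact: open_lower_orthant.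
split=> //.
- by split; [exact: borelT|exists u; exact: lifts_lawT].
- move=> B C CB [bB [b Bb]] [bC [c Cc]]; split; first exact: borelD.
  by exists (b - c); exact: lifts_lawD.
- move=> B Bnd HB; have bB i := (HB i).1.
  have [a aP] := choice (fun i => (HB i).2).
  have BS i : B i `<=` B i.+1 by apply/subsetPset/Bnd.
  split; first exact: borel_bigcup.
  have [|b ab] := seq_sup_exists dsc (g := a) (b := u).
    by move=> i; case: (aP i) => /andP[].
  by exists b; exact: (lifts_law_bigcup bB BS aP ab).
Qed.

Lemma joint_law_exists : exists y : set 'rV[R]_n -> G,
  [/\ forall A, borel A -> 0 <= y A <= u,
      y setT = u,
      forall A B, borel A -> borel B -> A `&` B = set0 ->
        y (A `|` B) = y A + y B,
      forall A : nat -> set 'rV[R]_n, (forall i, borel (A i)) ->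
        (forall i, A i `<=` A i.+1) ->
        seq_sup (fun i => y (A i)) (y (\bigcup_i A i))
    & forall c, y (lower_orthant c) = \big[lmeet/u]_(i < n) f i (c i)].
Proof.
have /choice[y yP] : forall A, exists a, borel A -> lifts_law A a.
  move=> A; have [/lifts_law_exists[a Aa]|nbA] := pselect (borel A).
    by exists a.
  by exists 0.
have uniq A a : borel A -> lifts_law A a -> y A = a.
  by move=> bA Aa; have yA := yP A bA; apply: le_anti;
    rewrite !(lifts_law_mono bA bA).
exists y; split.
- by move=> A /yP[].
- by apply: uniq lifts_lawT; exact: borelT.
- move=> A B bA bB AB0; have bAB := borelU bA bB.
  (* Additivity is read off from the proper difference of the union and [B], which is [A]. *)
  have := lifts_lawD bAB bB (@subsetUr _ A B) (yP _ bAB) (yP _ bB).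
  have -> : (A `|` B) `\` B = A by rewrite setDUl setDv setU0; exact/setDidPl.
  by move=> /(uniq A _ bA) ->; rewrite subrK.
- move=> A bA And; have [|b ab] := seq_sup_exists dsc (g := y \o A) (b := u).
    by move=> i; case: (yP _ (bA i)) => /andP[].
  rewrite (uniq _ b (borel_bigcup bA)) //.
  exact: lifts_law_bigcup bA And (fun i => yP _ (bA i)) ab.
- move=> c; apply: uniq (lifts_law_orthant c).
  by apply: sub_sigma_algebra; exact: open_lower_orthant.
Qed.

End JointLaw.

(** * The lexicographic product *)

Section LexBand.
Context {G : lGroupType} (e : G).
Implicit Types a b c z : lexZ G.

(** For [0 <= e], [collapse] sends the first half into [[0, e]] and the second into [[e, e + e]], so
    the order between the halves survives. *)
Definition lex_band z : Prop :=
  (z.1 = 0 /\ 0 <= z.2 <= e) \/ (z.1 = 1 /\ - e <= z.2 <= 0).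

(* On the band the lexicographic order is the pointwise one after [(1, 0)] has
   been replaced by the order unit [e + e] of [G]. *)
Definition collapse z : G := (e + e) *~ z.1 + z.2.

Lemma collapseD a b : collapse (a + b) = collapse a + collapse b.
Proof. by rewrite /collapse mulrzDr addrACA. Qed.

Lemma collapseN a : collapse (- a) = - collapse a.
Proof. by rewrite /collapse /= mulrNz -opprD. Qed.

Lemma collapse_unit : collapse (lexZ_unit G) = e + e.
Proof. by rewrite /collapse /= mulr1z addr0. Qed.

Lemma lex_band_compl z : lex_band z -> lex_band (lexZ_unit G - z).
Proof.
case: z => k g [[/= -> /andP[g0 ge]]|[/= -> /andP[ge g0]]]; [right|left];
  split; rewrite /= ?subrr ?subr0 // ?add0r.
  by rewrite lgroup_leN2 ge /= -oppr0 lgroup_leN2.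
by rewrite -oppr0 lgroup_leN2 g0 /= -[leRHS]opprK lgroup_leN2.
Qed.

Lemma collapse_mono a b : lex_band a -> lex_band b -> a <= b ->
  collapse a <= collapse b.
Proof.
case: a b => [k g] [l h]; rewrite lexZ_leE /collapse /=.
move=> [[/= -> /andP[g0 ge]]|[/= -> /andP[ge g0]]];
  move=> [[/= -> /andP[h0 he]]|[/= -> /andP[he h0]]]; rewrite ?ltxx ?eqxx //=;
  rewrite ?mulr0z ?mulr1z ?add0r ?lgroup_le2l // => _.
by rewrite (le_trans ge) // -addrA -[leLHS]addr0 lgroup_le2l
  addrC -lgroup_lesubl add0r.
Qed.

Lemma collapse_ge0 z : 0 <= e -> lex_band z -> 0 <= collapse z.
Proof.
move=> e0 bz; have b0 : lex_band 0 by left; rewrite /= lexx.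
have -> : 0 = collapse 0 by rewrite /collapse mulr0z add0r.
apply: collapse_mono => //; rewrite lexZ_leE.
by case: bz => -[/= -> /andP[]].
Qed.

Lemma collapse_le z : 0 <= e -> lex_band z -> collapse z <= e + e.
Proof.
move=> e0 bz; rewrite -collapse_unit -lgroup_subr_ge0 -collapseN -collapseD.
by apply: collapse_ge0 => //; exact: lex_band_compl.
Qed.

(** Comparable elements are settled by monotonicity; incomparable ones share their integer part, and
    the meet is taken in [G]. *)
Lemma lex_band_meet a b : lex_band a -> lex_band b ->
  lex_band (lmeet a b) /\ collapse (lmeet a b) = lmeet (collapse a) (collapse b).
Proof.
move=> ba bb; have [ab|nab] := boolP (a <= b).
  have -> : lmeet a b = a by exact/lmeet_idPl.
  by split=> //; apply/esym/lmeet_idPl; exact: collapse_mono.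
have [ba'|nba] := boolP (b <= a).
  have -> : lmeet a b = b by exact/lmeet_idPr.
  by split=> //; apply/esym/lmeet_idPr; exact: collapse_mono.
have ab1 : a.1 = b.1.
  by move: nab nba; rewrite !lexZ_leE !negb_or; case: ltgtP.
have -> : lmeet a b = (a.1, lmeet a.2 b.2).
  by rewrite /lmeet /= /lexZ_meet ab1 ltxx.
split; last by rewrite /collapse /= -ab1 ![_ *~ _ + _]addrC -lgroup_meetDr.
case: ba bb ab1 => [[a1 /andP[a0 ae]]|[a1 /andP[a0 ae]]];
  case=> [[b1 /andP[b0 be]]|[b1 /andP[b0 be]]]; rewrite a1 b1 // => _.
  by left; rewrite /= lmeet_ge0 // (le_trans (ge_lmeetl _ _)).
by right; rewrite /= le_lmeet a0 b0 (le_trans (ge_lmeetl _ _)).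
Qed.

End LexBand.

Lemma lex_band_le (G : lGroupType) (e e' : G) (z : lexZ G) :
  e <= e' -> lex_band e z -> lex_band e' z.
Proof.
move=> ee' [[z1 /andP[z0 ze]]|[z1 /andP[ez z0]]]; [left|right]; split=> //.
  by rewrite z0 (le_trans ze).
by rewrite z0 andbT (le_trans _ ez) // lgroup_leN2.
Qed.

(** * Suprema of sequences in the perfect MV-algebra *)

Section GammaSup.
Context {G : lGroupType}.
Local Notation Gam := (Gamma (lexZ_unit_ge0 G)).
Implicit Types (a b c : Gam) (s : nat -> Gam).

Lemma GammaP a : ((gval a).1 = 0 /\ 0 <= (gval a).2) \/
  ((gval a).1 = 1 /\ (gval a).2 <= 0).
Proof.
case: a => [[k g]] /= /andP[]; rewrite !lexZ_leE /=.
case: (ltgtP 0 k) => //= [k0 _|<- g0 _]; last by left.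
case: (ltgtP k 1) => //= [k1|-> g0]; last by right.
by move: k1; rewrite ltNge -gtz0_ge1 k0.
Qed.

Lemma Gamma_radical (g : G) : 0 <= g -> exists a, gval a = (0, g).
Proof.
move=> g0; have h : 0 <= ((0, g) : lexZ G) <= lexZ_unit G.
  by rewrite !lexZ_leE /= g0.
by exists (MkGamma (lexZ_unit_ge0 G) h).
Qed.

Lemma Gamma_coradical (g : G) : g <= 0 -> exists a, gval a = (1, g).
Proof.
move=> g0; have h : 0 <= ((1, g) : lexZ G) <= lexZ_unit G.
  by rewrite !lexZ_leE /= g0.
by exists (MkGamma (lexZ_unit_ge0 G) h).
Qed.

Lemma mv_is_sup_radical s c : mv_is_sup (range s) c ->
  (forall j, (gval (s j)).1 = 0) ->
  (gval c).1 = 0 /\ seq_sup (fun j => (gval (s j)).2) (gval c).2.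
Proof.
move=> [ub least] s1.
have s2 j : 0 <= (gval (s j)).2 by have := GammaP (s j); rewrite s1 => -[[]|[]].
have least' b : (forall j, gval (s j) <= gval b) -> gval c <= gval b.
  by move=> sb; apply/mv_le_gval/least => _ [j _ <-]; exact/mv_le_gval.
have sc j : gval (s j) <= gval c by apply/mv_le_gval/ub; exists j.
have [[c1 c2]|[c1 c2]] := GammaP c.
  split=> //; split=> [j|b sb].
    by have := sc j; rewrite lexZ_leE s1 c1 ltxx eqxx.
  have [b' b'E] := Gamma_radical (le_trans (s2 0%N) (sb 0%N)).
  have := least' b'; rewrite b'E lexZ_leE /= c1 ltxx eqxx; apply=> j.
  by rewrite lexZ_leE s1 /= sb.
(* Were [c] of integer part 1, lowering it by [s j] would leave an upper bound of the sequence. So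
   every [s j] vanishes, and then 0 is an upper bound, a contradiction. *)
have s0 j : (gval (s j)).2 = 0.
  have d2 : (gval c).2 - (gval (s j)).2 <= 0.
    by rewrite lgroup_lesubl add0r (le_trans c2).
  have [d dE] := Gamma_coradical d2; apply: le_anti; rewrite s2 andbT.
  have : gval c <= gval d by apply: least' => k; rewrite dE lexZ_leE s1.
  rewrite dE lexZ_leE /= c1 ltxx eqxx /= lgroup_lesubr -[leRHS]addr0.
  by rewrite lgroup_le2l.
suff : gval c <= gval (mv_zero : Gam) by rewrite lexZ_leE c1.
by apply: least' => j; rewrite lexZ_leE s1 s0 /= lexx.
Qed.

Lemma mv_is_sup_collapse (e : G) s c : mv_is_sup (range s) c ->
  (forall j, gval (s j) <= gval (s j.+1)) ->
  (forall j, lex_band e (gval (s j))) -> lex_band e (gval c) ->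
  seq_sup (fun j => collapse e (gval (s j))) (collapse e (gval c)).
Proof.
move=> sup_c sS bs bc; have [ub least] := sup_c.
have sc j : gval (s j) <= gval c by apply/mv_le_gval/ub; exists j.
split=> [j|b sb]; first exact: collapse_mono.
have [[c1 c2]|[c1 c2]] := GammaP c.
  have s1 j : (gval (s j)).1 = 0.
    have := sc j; rewrite lexZ_leE c1.
    by have [[-> _]|[-> _]] := GammaP (s j).
  have [_ [_ cleast]] := mv_is_sup_radical sup_c s1.
  rewrite /collapse c1 mulr0z add0r; apply: cleast => j.
  by have := sb j; rewrite /collapse s1 mulr0z add0r.
have [j0 s1] : exists j, (gval (s j)).1 = 1.
  apply: contrapT => nex; have [|c0 _] := mv_is_sup_radical sup_c.
    by move=> j; have [[]//|[s1 _]] := GammaP (s j); case: nex; exists j.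
  by rewrite c1 in c0.
have snd j k : (j <= k)%N -> gval (s j) <= gval (s k).
  by apply: (homo_leq (r := fun x y : Gam => gval x <= gval y))
    => [?|? ? ?|//]; [exact: lexx|exact: le_trans].
(* The bound [b] is pulled back to an element of integer part 1; the cap at 0 keeps it in the
   algebra when [b] exceeds [e + e]. *)
have [d dE] := @Gamma_coradical (lmeet (b - (e + e)) 0) (ge_lmeetr _ _).
have : gval c <= gval d.
  apply/mv_le_gval/least => _ [j _ <-]; apply/mv_le_gval.
  apply: le_trans (snd _ _ (leq_maxl j j0)) _.
  have : gval (s j0) <= gval (s (maxn j j0)) by exact: snd (leq_maxr _ _).
  have := sb (maxn j j0); rewrite dE !lexZ_leE s1 /=.
  have [[-> _]|[m1 m2]] := GammaP (s (maxn j j0)) => //.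
  rewrite /collapse m1 mulr1z ltxx eqxx /= => mb _.
  by rewrite le_lmeet m2 andbT lgroup_lesubr addrC.
rewrite dE lexZ_leE c1 /= le_lmeet => /andP[+ _].
by rewrite /collapse c1 mulr1z lgroup_lesubr addrC.
Qed.

End GammaSup.

(** * Elementary properties and uniqueness of observables *)

Section GammaObservable.
Context {G : lGroupType} {T : topologicalType}.
Local Notation Gam := (Gamma (lexZ_unit_ge0 G)).
Implicit Types (x : set T -> Gam) (A B : set T).

Lemma gval_observableU x A B : observable x -> borel A -> borel B ->
  A `&` B = set0 -> gval (x (A `|` B)) = gval (x A) + gval (x B).
Proof. by move=> [_ add _] bA bB AB0; apply/mv_psum_gval/add. Qed.

Lemma gval_observableT x : observable x -> gval (x setT) = lexZ_unit G.
Proof. by move=> [-> _ _]; exact: gval_one. Qed.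

Lemma gval_observableD x A B : observable x -> borel A -> borel B ->
  B `<=` A -> gval (x (A `\` B)) = gval (x A) - gval (x B).
Proof.
move=> ox bA bB BA; rewrite -{2}(setDUK BA) gval_observableU //.
- by rewrite [_ + gval (x (_ `\` _))]addrC addrK.
- exact: borelD.
- by rewrite setDE setICA setICr setI0.
Qed.

Lemma gval_observable_mono x A B : observable x -> borel A -> borel B ->
  A `<=` B -> gval (x A) <= gval (x B).
Proof.
move=> ox bA bB AB; rewrite -lgroup_subr_ge0 -gval_observableD //.
exact: gval_ge0.
Qed.

Lemma gval_observableC x A : observable x -> borel A ->
  gval (x (~` A)) = lexZ_unit G - gval (x A).
Proof.
by move=> ox bA; rewrite -setTD gval_observableD ?gval_observableT //; exact: borelT.
Qed.

(** Pi-lambda argument: differences are group differences, and increasing unions go to suprema,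
    which are unique. *)
Lemma observable_unique (P : set (set T)) x y : setI_closed P ->
  <<s P>> = @borel T -> observable x -> observable y ->
  (forall A, P A -> x A = y A) -> forall A, borel A -> x A = y A.
Proof.
move=> PI Pb ox oy Pxy; have bP A : P A -> borel A.
  by rewrite -Pb; exact: sub_sigma_algebra.
suff H : <<s P>> `<=` [set A | borel A /\ x A = y A].
  by move=> A; rewrite -Pb => /H[].
apply: lambda_system_subset => //; last first.
  by move=> A PA; split; [exact: bP|exact: Pxy].
split=> //.
- by split; [exact: borelT|apply: gval_inj; rewrite !gval_observableT].
- move=> A B BA [bA xyA] [bB xyB]; split; first exact: borelD.
  by apply: gval_inj; rewrite !gval_observableD // xyA xyB.
- move=> F Fnd xyF; have bF i := (xyF i).1.
  have FS i : F i `<=` F i.+1 by apply/subsetPset/Fnd.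
  split; first exact: borel_bigcup.
  case: ox => _ _ /(_ F bF FS)[ubx leastx].
  case: oy => _ _ /(_ F bF FS)[uby leasty].
  apply/gval_inj/le_anti/andP; split; apply/mv_le_gval.
    by apply: leastx => _ [i _ <-]; rewrite (xyF i).2; apply: uby; exists i.
  by apply: leasty => _ [i _ <-]; rewrite -(xyF i).2; apply: ubx; exists i.
Qed.

End GammaObservable.

(** * One-dimensional observables on rays *)

Section RealObservable.
Context {R : realType} {G : lGroupType}.
Local Notation Gam := (Gamma (lexZ_unit_ge0 G)).
Variables (x : set R -> Gam) (ox : observable x).
Local Notation ray t := [set r : R | r < t].
Local Notation F t := (gval (x (ray t))).

Lemma borel_ray (t : R) : borel (ray t).
Proof. by apply: sub_sigma_algebra; exact: open_lt. Qed.

Lemma ray_mono (s t : R) : s <= t -> F s <= F t.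
Proof.
move=> st; apply: gval_observable_mono => //; try exact: borel_ray.
by move=> r /= /lt_le_trans; apply.
Qed.

Lemma gval_Cray (t : R) : gval (x (~` ray t)) = lexZ_unit G - F t.
Proof. by rewrite gval_observableC //; exact: borel_ray. Qed.

Lemma bigcup_rayl (t : R) : \bigcup_k ray (t - k.+1%:R^-1) = ray t.
Proof.
apply/seteqP; split=> r /=.
  by move=> [k _ /=] /lt_le_trans; apply; rewrite gerBl invr_ge0.
move=> rt; exists (Num.truncn (t - r)^-1) => //=.
rewrite ltrBrDl -ltrBrDr -[ltRHS]invrK ltf_pV2 ?posrE ?ltr0n ?invr_gt0 ?subr_gt0 //.
exact: truncnS_gt.
Qed.

Lemma bigcup_rayT : \bigcup_k ray (k%:R : R) = setT.
Proof.
apply/seteqP; split=> // r _; exists (Num.truncn r).+1 => //=; exact: truncnS_gt.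
Qed.

Lemma bigcup_CrayT : \bigcup_k ~` ray (- k%:R : R) = setT.
Proof.
apply/seteqP; split=> // r _; exists (Num.truncn (- r)).+1 => //=.
by apply/negP; rewrite -leNgt lerNl ltW // truncnS_gt.
Qed.

Lemma bigcup_Crayr (t : R) : \bigcup_k ~` ray (t + k.+1%:R^-1) = [set r | t < r].
Proof.
apply/seteqP; split=> r /=.
  move=> [k _ /=] /negP; rewrite -leNgt; apply: lt_le_trans.
  by rewrite ltrDl invr_gt0.
move=> tr; exists (Num.truncn (r - t)^-1) => //=; apply/negP; rewrite -leNgt ltW //.
rewrite -ltrBrDl -[ltRHS]invrK ltf_pV2 ?posrE ?ltr0n ?invr_gt0 ?subr_gt0 //.
exact: truncnS_gt.
Qed.

Lemma ray_supl t : mv_is_sup (range (fun k => x (ray (t - k.+1%:R^-1)))) (x (ray t)).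
Proof.
case: ox => _ _ cont; rewrite -[X in mv_is_sup _ (x X)]bigcup_rayl.
apply: cont => [k|k r /=].
  exact: borel_ray.
move=> /lt_le_trans; apply; rewrite lerD2l lerN2 lef_pV2 ?posrE ?ltr0n //.
by rewrite ler_nat.
Qed.

Lemma ray_supT : mv_is_sup (range (fun k => x (ray k%:R))) (x setT).
Proof.
case: ox => _ _ cont; rewrite -bigcup_rayT; apply: cont => [k|k r /=].
  exact: borel_ray.
by move=> /lt_le_trans; apply; rewrite ler_nat.
Qed.

Lemma Cray_supT : mv_is_sup (range (fun k => x (~` ray (- k%:R)))) (x setT).
Proof.
case: ox => _ _ cont; rewrite -bigcup_CrayT; apply: cont => [k|k r /=].
  by apply: borelC; exact: borel_ray.
by apply: contra_not => /lt_le_trans; apply; rewrite lerN2 ler_nat.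
Qed.

Lemma Cray_supr t :
  mv_is_sup (range (fun k => x (~` ray (t + k.+1%:R^-1)))) (x [set r | t < r]).
Proof.
case: ox => _ _ cont; rewrite -bigcup_Crayr; apply: cont => [k|k r /=].
  by apply: borelC; exact: borel_ray.
apply: contra_not => /lt_le_trans; apply.
by rewrite lerD2l lef_pV2 ?posrE ?ltr0n // ler_nat.
Qed.

(* The first coordinate of [x] is a two-valued sigma-additive measure, hence the
   Dirac mass at some [t]. *)
Lemma observable_ray_band : exists (t : R) (e : G), 0 <= e /\
  forall s, lex_band e (F s) /\ (F s).1 = (t < s)%R%:Z.
Proof.
pose S := [set s | (F s).1 = 0].
have Fcase s : (F s).1 <> 0 -> (F s).1 = 1.
  by case: (GammaP (x (ray s))) => [[-> //]|[->]].
have Sdown r s : r <= s -> S s -> S r.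
  move=> /ray_mono; rewrite lexZ_leE /S /= => + s0; rewrite s0.
  by have [[-> _]|[-> _]] := GammaP (x (ray r)).
have T1 : (gval (x setT)).1 = 1 by rewrite gval_observableT.
have [b Sb] : exists b, ~ S b.
  apply: contrapT => nex; have [|c0 _] := mv_is_sup_radical ray_supT.
    by move=> k; apply: contrapT => Sk; apply: nex; exists k%:R.
  by rewrite T1 in c0.
have [a Sa] : exists a, S a.
  apply: contrapT => nex; have [|c0 _] := mv_is_sup_radical Cray_supT.
    move=> k; rewrite gval_Cray /= Fcase ?subrr // => Sk.
    by apply: nex; exists (- k%:R).
  by rewrite T1 in c0.
have hS : has_sup S.
  split; first by exists a.
  exists b => s Ss; rewrite leNgt; apply/negP => /ltW bs; apply: Sb.
  exact: Sdown bs Ss.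
pose t := sup S.
have Slt s : s < t -> S s.
  move=> st; have [r Sr sr] := sup_gt (ex_intro _ a Sa) st.
  exact: Sdown (ltW sr) Sr.
have nSgt s : t < s -> ~ S s.
  by move=> ts Ss; have := lt_le_trans ts (sup_upper_bound hS Ss); rewrite ltxx.
(* Both open half-lines at [t] have integer part 0, being increasing unions of sets of integer part
   0; the mass sits at [t]. *)
have [|St _] := mv_is_sup_radical (ray_supl t).
  by move=> k; apply: Slt; rewrite gtrBl invr_gt0.
have [|U1 _] := mv_is_sup_radical (Cray_supr t).
  move=> k; rewrite gval_Cray /= Fcase ?subrr //.
  by apply: nSgt; rewrite ltrDl invr_gt0.
have F2 : 0 <= (F t).2 by case: (GammaP (x (ray t))); rewrite St => -[].
have U2 : 0 <= (gval (x [set r | t < r])).2.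
  by case: (GammaP (x [set r | t < r])); rewrite U1 => -[].
(* By monotonicity [e1] bounds the infinitesimal part up to [t] and [e2] its defect beyond [t]; the
   sum serves for both. *)
set e1 := (F t).2 in F2; set e2 := (gval (x [set r | t < r])).2 in U2.
have bU : borel [set r | t < r] by apply: sub_sigma_algebra; exact: open_gt.
exists t, (e1 + e2); split; first exact: lgroup_addr_ge0.
move=> s; case: leP => [st|ts] /=.
  have Ss : S s by exact: Sdown st St.
  split=> //; left; split=> //.
  have -> : 0 <= (F s).2 by case: (GammaP (x (ray s))); rewrite Ss => -[].
  have := ray_mono st; rewrite lexZ_leE Ss St /= => /le_trans; apply.
  by rewrite -[leLHS]addr0 lgroup_le2l.
have s1 : (F s).1 = 1 by apply/Fcase/nSgt.
split=> //; right; split=> //.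
have -> : (F s).2 <= 0 by case: (GammaP (x (ray s))); rewrite s1 => -[].
have : gval (x (~` [set r | t < r])) <= F s.
  apply: gval_observable_mono => //; [exact: borelC|exact: borel_ray|].
  by move=> r /= /negP; rewrite -leNgt => /le_lt_trans; apply.
rewrite gval_observableC // lexZ_leE s1 /= U1 subr0 ltxx eqxx /= sub0r andbT.
by apply: le_trans; rewrite lgroup_leN2 -[leLHS]add0r lgroup_le2r.
Qed.

End RealObservable.

(** * The joint observable on the interval algebra *)

Section GammaJoint.
Context {R : realType} {G : lGroupType} (dsc : dedekind_sigma_complete G).
Local Notation Gam := (Gamma (lexZ_unit_ge0 G)).
Context {n : nat} (x_ : 'I_n -> set R -> Gam).
Hypothesis ox_ : forall i, observable (x_ i).
Local Notation ray t := [set r : R | r < t].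

Lemma Gamma_joint_observable : exists x : set 'rV[R]_n -> Gam,
  observable x /\ forall s : 'I_n -> R,
    x (lower_orthant s) = \big[mv_meet/mv_one]_(i < n) x_ i (ray (s i)).
Proof.
have /choice[te teP] : forall i, exists te : R * G, 0 <= te.2 /\
    forall s, lex_band te.2 (gval (x_ i (ray s))) /\
      (gval (x_ i (ray s))).1 = (te.1 < s)%R%:Z.
  by move=> i; have [t [e ?]] := observable_ray_band (ox_ i); exists (t, e).
(* A common bound is needed so that a single [collapse] treats all the observables. *)
pose e := \sum_i (te i).2.
have sum_ge0 (P : pred 'I_n) : 0 <= \sum_(i | P i) (te i).2.
  elim/big_ind: _ => [|a b|i _]; [exact: lexx|exact: lgroup_addr_ge0|].
  exact: (teP i).1.
have e0 : 0 <= e by exact: sum_ge0.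
have band i s : lex_band e (gval (x_ i (ray s))).
  apply: lex_band_le ((teP i).2 s).1.
  by rewrite /e (bigD1 i) //= -[leLHS]addr0 lgroup_le2l.
have unit_band : lex_band e (lexZ_unit G).
  by right; rewrite /= lexx -oppr0 lgroup_leN2 e0.
pose u := e + e; have u0 : 0 <= u by exact: lgroup_addr_ge0.
pose f i s := collapse e (gval (x_ i (ray s))).
have [] := @joint_law_exists R G dsc u u0 n f.
- by move=> i a b ab; apply: collapse_mono => //; exact: ray_mono.
- by move=> i t; exact: collapse_ge0.
- by move=> i t; exact: collapse_le.
- move=> i t; apply: mv_is_sup_collapse (ray_supl (ox_ i) t) _ _ _ => // k.
  apply: ray_mono => //.
  by rewrite lerD2l lerN2 lef_pV2 ?posrE ?ltr0n // ler_nat.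
- move=> i; rewrite /u -collapse_unit -(gval_observableT (ox_ i)).
  apply: mv_is_sup_collapse (ray_supT (ox_ i)) _ _ _ => [k|//|].
    by apply: ray_mono => //; rewrite ler_nat.
  by rewrite gval_observableT.
- move=> i; have := mv_is_sup_collapse (e := e) (Cray_supT (ox_ i)).
  rewrite gval_observableT // collapse_unit.
  have fE k : collapse e (gval (x_ i (~` ray (- k%:R)))) = u - f i (- k%:R).
    by rewrite gval_Cray // collapseD collapseN collapse_unit.
  move=> supC; have : seq_sup (fun k =>
      collapse e (gval (x_ i (~` ray (- k%:R))))) (e + e).
    apply: supC => [k|k|//].
      rewrite !gval_Cray // lgroup_le2l lgroup_leN2 ray_mono //.
      by rewrite lerN2 ler_nat.
    by rewrite gval_Cray //; exact: lex_band_compl.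
  by under eq_fun do rewrite fE.
move=> y [yu yT yU ysup yorth].
pose t : 'rV[R]_n := \row_i (te i).1.
pose atom (A : set 'rV[R]_n) : int := `[< A t >].
(* The collapse is undone: the Dirac mass at [t] is the integer part, and its contribution [u] is
   removed from [y A]. *)
have /choice[x xP] : forall A, exists a : Gam, borel A ->
    gval a = (atom A, y A - u *~ atom A).
  move=> A; have [bA|nbA] := pselect (borel A); last by exists mv_zero.
  have /andP[y0 yle] := yu A bA; rewrite /atom; case: asboolP => At.
    have [|a aE] := @Gamma_coradical G (y A - u).
      by rewrite lgroup_lesubl add0r.
    by exists a; rewrite aE mulr1z.
  by have [a aE] := Gamma_radical y0; exists a; rewrite aE mulr0z subr0.
exists x; split; [split|].
- apply: gval_inj; rewrite xP ?gval_one; last exact: borelT.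
  by rewrite /atom asboolT // yT mulr1z subrr.
- move=> A B bA bB AB0; apply/mv_psum_gval.
  rewrite !xP ?yU //; last exact: borelU.
  have atomU : atom (A `|` B) = atom A + atom B.
    rewrite /atom asbool_or; case: asboolP => At; case: asboolP => Bt //.
    by have : (A `&` B) t by []; rewrite AB0.
  congr pair => //=.
  by rewrite atomU mulrzDr opprD addrACA.
- move=> A bA And; have bU := borel_bigcup bA; have [ysup1 ysup2] := ysup A bA And.
  split=> [_ [i _ <-]|b ub].
    apply/mv_le_gval; rewrite !xP // lexZ_leE /= /atom.
    case: asboolP => Ait; last first.
      case: asboolP => // _; rewrite ltxx eqxx /= !mulr0z !subr0.
      exact: ysup1.
    rewrite asboolT; last by exists i.
    by rewrite ltxx eqxx /= lgroup_le2r; exact: ysup1.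
  have {}ub i : gval (x (A i)) <= gval b by apply/mv_le_gval/ub; exists i.
  apply/mv_le_gval; rewrite xP // lexZ_leE /= /atom.
  have Amono i j : (i <= j)%N -> A i `<=` A j.
    by apply: (homo_leq (r := fun B C : set 'rV[R]_n => B `<=` C))
      => [?|? ? ?|//]; [exact: subset_refl|exact: subset_trans].
  have ymono i j : (i <= j)%N -> y (A i) <= y (A j).
    move=> /Amono Aij; have bD := borelD (bA j) (bA i).
    rewrite -(setDUK Aij) yU ?setDE 1?setICA ?setICr ?setI0 -?setDE //.
    by rewrite -[leLHS]addr0 lgroup_le2l; case/andP: (yu _ bD).
  case: asboolP => [[i0 _ Ai0]|nA].
    have b1 : (gval b).1 = 1.
      have := ub i0; rewrite xP // lexZ_leE /= /atom asboolT //.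
      by have [[-> _]|[-> _]] := GammaP b.
    rewrite b1 ltxx eqxx /= lgroup_lesubl; apply: ysup2 => i.
    (* Before index [i0] the set may miss [t] and the comparison in [G] gives nothing, so a later
       index is used. *)
    have Ait : A (maxn i i0) t by apply: Amono Ai0; exact: leq_maxr.
    have := ub (maxn i i0); rewrite xP // lexZ_leE /= /atom asboolT // b1.
    rewrite ltxx eqxx /= lgroup_lesubl; apply: le_trans.
    by apply: ymono; exact: leq_maxl.
  have [[b1 b2]|[-> _]] := GammaP b; last by [].
  rewrite b1 ltxx eqxx /= mulr0z subr0; apply: ysup2 => i.
  have := ub i; rewrite xP // lexZ_leE /= /atom asboolF; last first.
    by move=> Ait; apply: nA; exists i.
  by rewrite b1 ltxx eqxx /= mulr0z subr0.
- move=> s; apply: gval_inj; rewrite xP ?yorth; last first.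
    by apply: sub_sigma_algebra; exact: open_lower_orthant.
  have key (r : seq 'I_n) :
      let z := gval (\big[mv_meet/mv_one]_(i <- r) x_ i (ray (s i))) in
      [/\ lex_band e z, collapse e z = \big[lmeet/u]_(i <- r) f i (s i)
        & z.1 = all (fun i => (te i).1 < s i) r].
    elim: r => [|i r [zb zc z1]] /=.
      by rewrite !big_nil gval_one collapse_unit.
    rewrite !big_cons gval_meet; have [mb mc] := lex_band_meet (band i (s i)) zb.
    split=> //; first by rewrite mc zc.
    have := ((teP i).2 (s i)).2; move: z1.
    set z := gval (\big[_/_]_(_ <- _) _); set w := gval _ => z1 w1.
    rewrite /lmeet /= /lexZ_meet w1 z1.
    by case: ((te i).1 < s i)%R w1 => w1; case: (all _ _) z1 => z1 //=;
      rewrite ?z1 ?w1.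
  have [_ zc z1] := key (index_enum 'I_n).
  rewrite -zc; set z := gval _ in zc z1 *; rewrite [RHS]surjective_pairing.
  have <- : z.1 = atom (lower_orthant s).
    rewrite z1 /atom; congr (Posz (nat_of_bool _)).
    apply/allP/asboolP => [H i|H i _].
      by rewrite mxE; apply: H; exact: mem_index_enum.
    by have := H i; rewrite mxE.
  by congr pair; rewrite /collapse addrAC subrr add0r.
Qed.

End GammaJoint.

(** * Transport of observables along isomorphisms *)

Section MVIsomorphism.
Context {M N : mvAlgebraType} (h : M -> N) (h' : N -> M).
Hypotheses (hK : cancel h h') (h'K : cancel h' h).
Hypotheses (h0 : h mv_zero = mv_zero)
  (hD : forall a b, h (mv_oplus a b) = mv_oplus (h a) (h b))
  (hN : forall a, h (mv_neg a) = mv_neg (h a)).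

Lemma mv_iso_one : h mv_one = mv_one.
Proof. by rewrite /mv_one hN h0. Qed.

Lemma mv_iso_meet a b : h (mv_meet a b) = mv_meet (h a) (h b).
Proof. by rewrite /mv_meet /mv_join !(hN, hD). Qed.

Lemma mv_iso_le a b : mv_le a b <-> mv_le (h a) (h b).
Proof.
rewrite /mv_le -hN -hD -mv_iso_one.
by split=> [->//|]; exact: (can_inj hK).
Qed.

Lemma mv_iso_observable (T : topologicalType) (x : set T -> M) :
  observable x -> observable (h \o x).
Proof.
move=> [xT xU xS]; split=> [|A B bA bB AB0|A bA And] /=.
- by rewrite xT mv_iso_one.
- have [le_ab ab] := xU A B bA bB AB0.
  by split; [rewrite -hN -mv_iso_le|rewrite ab hD].
- have [ub least] := xS A bA And; split=> [_ [i _ <-]|b bub].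
    by rewrite -mv_iso_le; apply: ub; exists i.
  rewrite -[b]h'K -mv_iso_le; apply: least => _ [i _ <-].
  by rewrite mv_iso_le h'K; apply: bub; exists i.
Qed.

End MVIsomorphism.

(** * Existence and uniqueness of the joint observable *)

Theorem theorem5p2 (R : realType) (M : mvAlgebraType)
    (hM : rad_dedekind_sigma_complete_perfect M)
    (n : nat) (hn : (1 <= n)%N)
    (x_ : 'I_n -> set R -> M) (hx : forall i, observable (x_ i)) :
  let joint (x : set 'rV[R]_n -> M) :=
    observable x /\
    forall s : 'I_n -> R,
      x (lower_orthant s) =
      \big[mv_meet/mv_one]_(i < n) x_ i [set t | t < s i] in
  exists x : set 'rV[R]_n -> M,
    joint x /\
    forall y : set 'rV[R]_n -> M, joint y ->
      forall A : set 'rV[R]_n, borel A -> y A = x A.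
Proof.
move=> joint; have [G [dsc [h [[h' hK h'K] h0 hD hN]]]] := hM.
have h'0 : h' mv_zero = mv_zero by rewrite -h0 hK.
have h'D a b : h' (mv_oplus a b) = mv_oplus (h' a) (h' b).
  by apply: (can_inj hK); rewrite hD !h'K.
have h'N a : h' (mv_neg a) = mv_neg (h' a).
  by apply: (can_inj hK); rewrite hN !h'K.
have ohx i : observable (h \o x_ i) by exact: mv_iso_observable (hx i).
have [z [oz zE]] := Gamma_joint_observable dsc ohx.
have ox : observable (h' \o z) by exact: mv_iso_observable oz.
have jx : joint (h' \o z).
  split=> // s; rewrite /= zE.
  rewrite (big_morph h' (mv_iso_meet h'D h'N) (mv_iso_one h'0 h'N)).
  by apply: eq_bigr => i _; rewrite /= hK.
exists (h' \o z); split=> // y [oy yE] A bA; apply: (can_inj hK).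
apply: (observable_unique (P := orthants) _ _ (x := h \o y)
  (y := h \o (h' \o z))) => //.
- exact: orthants_setI.
- by rewrite borel_orthants.
- exact: mv_iso_observable oy.
- exact: mv_iso_observable ox.
- by move=> _ [s _ <-]; rewrite /comp yE -jx.2.
Qed.
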